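(* Every infinite 2-connected subcubic graph $G$ has a spanning subgraph that is a cactus and is faithful to $G$.
   Context: Subcubic means maximum degree at most 3. A (finite or infinite) cactus is a subcubic graph that is the union of a class $\mathcal{C}$ of cycles and a class $\mathcal{P}$ of paths such that (1) any two cycles in $\mathcal{C}$ are vertex-disjoint, (2) any two paths in $\mathcal{P}$ are vertex-disjoint, and (3) the graph obtained by contracting every cycle in $\mathcal{C}$ is a tree. A ray is a one-way infinite path; two rays of a graph $H$ are equivalent in $H$ if for every finite $S\subseteq V(H)$ some component of $H-S$ contains tails of both; the equivalence classes are the ends of $H$. A subgraph $F$ of $G$ is faithful to $G$ if (i) every end of $G$ contains a ray of $F$, and (ii) any two rays of $F$ are equivalent in $F$ if and only if they are equivalent in $G$. *)

(* Defs.v *)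
From Stdlib Require Import List Arith.
Import ListNotations.

Definition graph (V : Type) := V -> V -> Prop.

Definition simple {V} (G : graph V) : Prop :=
  (forall u v, G u v -> G v u) /\ (forall v, ~ G v v).

Definition subgraph {V} (F G : graph V) : Prop := forall u v, F u v -> G u v.

Definition subcubic {V} (G : graph V) : Prop :=
  forall (v : V) (l : list V), NoDup l -> (forall u, In u l -> G v u) -> length l <= 3.

Definition infinite_type (V : Type) : Prop := forall l : list V, exists v, ~ In v l.

Inductive conn_avoid {V} (G : graph V) (S : V -> Prop) : V -> V -> Prop :=
| ca_refl v : ~ S v -> conn_avoid G S v v
| ca_step u v w : ~ S u -> G u v -> conn_avoid G S v w -> conn_avoid G S u w.

Definition connected {V} (G : graph V) : Prop :=
  forall u v, conn_avoid G (fun _ => False) u v.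

Definition two_connected {V} (G : graph V) : Prop :=
  (exists a b c : V, a <> b /\ b <> c /\ a <> c) /\
  connected G /\
  (forall x u v, u <> x -> v <> x -> conn_avoid G (fun y => y = x) u v).

Definition is_ray {V} (H : graph V) (r : nat -> V) : Prop :=
  (forall m n, r m = r n -> m = n) /\ (forall n, H (r n) (r (S n))).

Definition ray_equiv {V} (H : graph V) (r1 r2 : nat -> V) : Prop :=
  forall S : list V, exists m n,
    (forall i, ~ In (r1 (m + i)) S) /\
    (forall j, ~ In (r2 (n + j)) S) /\
    conn_avoid H (fun x => In x S) (r1 m) (r2 n).

(* F faithful to G: every end of G contains a ray of F, and rays of F are
   equivalent in F iff they are equivalent in G *)
Definition faithful {V} (F G : graph V) : Prop :=
  (forall r, is_ray G r -> exists r', is_ray F r' /\ ray_equiv G r r') /\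
  (forall r1 r2, is_ray F r1 -> is_ray F r2 ->
     (ray_equiv F r1 r2 <-> ray_equiv G r1 r2)).

Fixpoint chain {V} (F : graph V) (x : V) (l : list V) : Prop :=
  match l with
  | [] => True
  | y :: l' => F x y /\ chain F y l'
  end.

Definition is_path {V} (F : graph V) (p : list V) : Prop :=
  match p with
  | [] => False
  | x :: l => NoDup p /\ chain F x l
  end.

Definition is_cycle {V} (F : graph V) (c : list V) : Prop :=
  match c with
  | [] => False
  | x :: l => 3 <= length c /\ NoDup c /\ chain F x l /\ F (last l x) x
  end.

Definition path_edge {V} (p : list V) (u v : V) : Prop :=
  exists l1 l2, p = l1 ++ u :: v :: l2 \/ p = l1 ++ v :: u :: l2.

Definition cycle_edge {V} (c : list V) (u v : V) : Prop :=
  path_edge c u v \/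
  (exists x l, c = x :: l /\ ((u = last l x /\ v = x) \/ (v = last l x /\ u = x))).

(* vertices identified by contracting every cycle of the class C *)
Definition same_bag {V} (C : list V -> Prop) (u v : V) : Prop :=
  u = v \/ exists c, C c /\ In u c /\ In v c.

Definition contracted_edge {V} (C : list V -> Prop) (u v : V) : Prop :=
  exists c, C c /\ cycle_edge c u v.

(* remaining edges of F; each becomes an edge of the contracted multigraph
   between the bags of its endpoints (possibly a loop or parallel edge) *)
Definition qedge {V} (F : graph V) (C : list V -> Prop) (u v : V) : Prop :=
  F u v /\ ~ contracted_edge C u v.

(* a cycle of the contracted multigraph: a cyclic sequence of k >= 1 distinct
   remaining edges (a_i,b_i), with b_i and a_{i+1} in the same bag (indices mod k),
   and the bags of a_0, ..., a_{k-1} pairwise distinct *)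
Definition qcycle {V} (F : graph V) (C : list V -> Prop) (es : list (V * V)) : Prop :=
  es <> [] /\
  (forall e, In e es -> qedge F C (fst e) (snd e)) /\
  (forall i j e1 e2, i <> j -> nth_error es i = Some e1 -> nth_error es j = Some e2 ->
     e1 <> e2 /\ e1 <> (snd e2, fst e2)) /\
  (forall i e1 e2, nth_error es i = Some e1 ->
     nth_error es (Nat.modulo (S i) (length es)) = Some e2 ->
     same_bag C (snd e1) (fst e2)) /\
  (forall i j e1 e2, i <> j -> nth_error es i = Some e1 -> nth_error es j = Some e2 ->
     ~ same_bag C (fst e1) (fst e2)).

Definition contraction_is_tree {V} (F : graph V) (C : list V -> Prop) : Prop :=
  (forall u v, conn_avoid (fun a b => same_bag C a b \/ qedge F C a b) (fun _ => False) u v) /\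
  ~ (exists es, qcycle F C es).

Definition cactus {V} (F : graph V) : Prop :=
  subcubic F /\
  exists (C P : list V -> Prop),
    (forall c, C c -> is_cycle F c) /\
    (forall p, P p -> is_path F p) /\
    (forall c1 c2 x, C c1 -> C c2 -> In x c1 -> In x c2 -> c1 = c2) /\
    (forall p1 p2 x, P p1 -> P p2 -> In x p1 -> In x p2 -> p1 = p2) /\
    (forall v, (exists c, C c /\ In v c) \/ (exists p, P p /\ In v p)) /\
    (forall u v, F u v -> (exists c, C c /\ cycle_edge c u v) \/
                          (exists p, P p /\ path_edge p u v)) /\
    contraction_is_tree F C.

(* Main.v *)
Require Import Defs.
From Stdlib Require Import List Arith Lia Permutation Classical ClassicalEpsilon.
From Stdlib Require Import FunctionalExtensionality PropExtensionality.
Import ListNotations.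

(* The cactus is grown outwards from a vertex. At each step there is a connected piece still to be
   spanned, entered by one edge at a vertex [start]; its 2-edge-connected class (block) of [start]
   is either [start] alone or contains, by Whitney, a cycle through [start] and one other chosen
   vertex. Span that vertex or cycle. The components left over inside the block are entered from
   the new cycle. Everything else hangs off the block by bridges; all these parts but one can be
   entered from the older cycle (the anchor) from which the chain of blocks began, and the
   remaining one, towards the [target], continues the chain through the second vertex of the cycle.
   Hence every spanned vertex lies on a cycle or has degree at most 2, and contracting the cycles
   gives a tree.
   A part entered from the anchor uses up an anchor vertex and continuing the chain approaches the
   target, so infinitely often a new piece inside a block is chosen. Such a piece is separated from
   the rest of the cactus by its anchor, which gives faithfulness; choosing its target of minimal
   distance rank makes the cactus spanning. *)

(** * Walks and cycles *)

(** The obstacle is the degree. Several parts may hang from a vertex that is a block by itself, but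
    off the cycles only one path may run on through it, so only the part towards the target is
    entered from there. Bridgelessness gives the others a second way in: a part tied to the rest of
    its piece by one edge must have an edge that leaves the piece, and [inv_bridge] keeps such an
    edge ending at the anchor. An anchor is always a cycle, so an entering edge at one of its
    vertices is the third edge there. No global sequence of stages is built. Each vertex follows the
    piece that contains it, and since all choices depend on sets alone, the vertices of one piece
    agree. For faithfulness, pieces have finite boundary in [G], so equivalent rays end up in the
    same pieces. *)

Inductive walk {V} (E : graph V) (K : V -> Prop) : V -> V -> Prop :=
| walk_refl v : K v -> walk E K v v
| walk_step u v w : K u -> E u v -> walk E K v w -> walk E K u w.

Definition cut {V} (E : graph V) (a b : V) : graph V :=
  fun x y => E x y /\ ~ (x = a /\ y = b) /\ ~ (x = b /\ y = a).

Definition symm {V} (E : graph V) : Prop := forall u v, E u v -> E v u.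

Section Walks.
Context {V : Type}.
Implicit Types (E : graph V) (K P : V -> Prop).

Lemma walk_in_l E K u v : walk E K u v -> K u.
Proof. destruct 1; auto. Qed.

Lemma walk_in_r E K u v : walk E K u v -> K v.
Proof. induction 1; auto. Qed.

Lemma walk_trans E K u v w : walk E K u v -> walk E K v w -> walk E K u w.
Proof. induction 1; eauto using walk_step. Qed.

Lemma walk_edge E K u v : K u -> K v -> E u v -> walk E K u v.
Proof. eauto using walk_step, walk_refl. Qed.

Lemma walk_sym E K u v : symm E -> walk E K u v -> walk E K v u.
Proof.
  intros HE; induction 1; [constructor; auto|].
  eapply walk_trans; [eassumption|].
  apply walk_edge; auto. eapply walk_in_l; eauto.
Qed.

Lemma walk_mono E E' K K' u v :
  (forall x, K x -> K' x) -> (forall x y, K x -> K y -> E x y -> E' x y) ->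
  walk E K u v -> walk E' K' u v.
Proof.
  intros HK HE; induction 1; [constructor; auto|].
  eapply walk_step; eauto. apply HE; auto. eapply walk_in_l; eauto.
Qed.

Lemma walk_exit E K P u v :
  walk E K u v -> P u -> ~ P v -> exists x y, P x /\ ~ P y /\ K x /\ K y /\ E x y.
Proof.
  induction 1 as [|u v w Ku Euv W IH]; intros Pu Pv; [contradiction|].
  destruct (classic (P v)); [auto|].
  exists u, v. repeat split; auto. eapply walk_in_l; eauto.
Qed.

(** Makes a component connected within itself, as [inv_conn] demands of a new piece. The base point
    [r] stays fixed while the walk is consumed. *)
Lemma walk_in_component E K u v : walk E K u v -> walk E (walk E K u) u v.
Proof.
  intros W; assert (H : forall r, walk E K r u -> walk E (walk E K r) u v);
    [|apply H; constructor; eapply walk_in_l; eauto].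
  induction W as [v Kv|u v w Ku Euv W IH]; intros r Wr; [constructor; auto|].
  eapply walk_step; eauto. apply IH.
  eapply walk_trans; eauto. apply walk_edge; auto. eapply walk_in_l; eauto.
Qed.

Lemma walk_conn_avoid E K (S : V -> Prop) u v :
  (forall x, K x -> ~ S x) -> walk E K u v -> conn_avoid E S u v.
Proof. intros H; induction 1; econstructor; eauto. Qed.

Lemma conn_avoid_walk E K (S : V -> Prop) u v :
  (forall x, ~ S x -> K x) -> conn_avoid E S u v -> walk E K u v.
Proof. intros H; induction 1; econstructor; eauto. Qed.

Lemma cut_symm E a b : symm E -> symm (cut E a b).
Proof. intros H x y (H1 & H2 & H3). repeat split; auto; tauto. Qed.

Lemma cut_comm E a b x y : cut E a b x y -> cut E b a x y.
Proof. unfold cut; tauto. Qed.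

Lemma chain_mid E x l1 m l2 :
  chain E x (l1 ++ m :: l2) <-> chain E x (l1 ++ [m]) /\ chain E m l2.
Proof.
  revert x; induction l1 as [|a l1 IH]; intros x; simpl; [tauto|].
  rewrite IH; tauto.
Qed.

Lemma last_cons (a x : V) l : last (a :: l) x = last l a.
Proof.
  revert a x; induction l as [|b l IH]; intros a x; [reflexivity|].
  change (last (a :: b :: l) x) with (last (b :: l) x).
  now rewrite !IH.
Qed.

Lemma chain_snoc E x l y : chain E x (l ++ [y]) <-> chain E x l /\ E (last l x) y.
Proof.
  revert x; induction l as [|a l IH]; intros x; [simpl; tauto|].
  change ((a :: l) ++ [y]) with (a :: (l ++ [y])). rewrite last_cons.
  simpl chain. rewrite IH; tauto.
Qed.

Lemma chain_rev E x l y : symm E -> chain E x (l ++ [y]) -> chain E y (rev l ++ [x]).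
Proof.
  intros HE; revert x; induction l as [|a l IH]; intros x H; simpl in *.
  - split; [apply HE|]; tauto.
  - rewrite <- app_assoc. apply chain_mid. split; [apply IH; tauto|].
    simpl; split; [apply HE|]; tauto.
Qed.

Lemma chain_mono E E' x l : (forall u v, E u v -> E' u v) -> chain E x l -> chain E' x l.
Proof. intros H; revert x; induction l; simpl; intuition. Qed.

Lemma chain_edge E x l l1 u v l2 : chain E x l -> x :: l = l1 ++ u :: v :: l2 -> E u v.
Proof.
  revert x l; induction l1 as [|a l1 IH]; intros x l H e; simpl in e.
  - injection e as -> ->. simpl in H; tauto.
  - injection e as -> ->. destruct l1 as [|b l1]; simpl in H.
    + apply (IH u (v :: l2)); [simpl; tauto|reflexivity].
    + apply (IH b (l1 ++ u :: v :: l2)); [tauto|reflexivity].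
Qed.

Lemma walk_path E K u v : walk E K u v ->
  exists l, chain E u l /\ last l u = v /\ NoDup (u :: l) /\ Forall K (u :: l).
Proof.
  induction 1 as [v Kv|u u' v Ku Euv W (l & Hc & Hl & Hn & HK)].
  - exists []; repeat split; simpl; auto. constructor; auto. constructor.
  - destruct (classic (In u (u' :: l))) as [Hin|Hin].
    + apply in_split in Hin. destruct Hin as (a & b & e).
      exists b.
      assert (Hb : chain E u b /\ last b u = v).
      { destruct a as [|a0 a]; simpl in e; injection e as -> ->; [auto|].
        apply chain_mid in Hc. split; [tauto|].
        rewrite <- Hl. clear. revert a0; induction a as [|c a IH]; intros a0; simpl app.
        - now rewrite last_cons.
        - rewrite last_cons. apply IH. }
      rewrite e in Hn, HK. apply Forall_app in HK.
      apply NoDup_remove in Hn as Hn'. repeat split; try tauto.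
      clear - Hn. induction a; [exact Hn|]. inversion Hn; auto.
    + exists (u' :: l). repeat split; auto.
      * now rewrite last_cons.
      * constructor; auto.
Qed.

Lemma walk_hit E K P u v : walk E K u v -> ~ P u -> P v ->
  exists y x, walk E (fun z => K z /\ ~ P z) u y /\ E y x /\ P x /\ K x.
Proof.
  induction 1 as [|u u' v Ku Euv W IH]; intros Pu Pv; [contradiction|].
  destruct (classic (P u')) as [Pu'|Pu'].
  - exists u, u'. repeat split; auto. constructor; auto. eapply walk_in_l; eauto.
  - destruct (IH Pu' Pv) as (y & x & W' & H). exists y, x. split; auto.
    eapply walk_step; eauto.
Qed.

(** * Cycles as lists *)

(** Repeating the first vertex at the end makes the closing edge an ordinary chain edge, so rotation
    and reversal become list manipulations. *)
Lemma is_cycle_closed E x l :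
  is_cycle E (x :: l) <-> 3 <= length (x :: l) /\ NoDup (x :: l) /\ chain E x (l ++ [x]).
Proof. unfold is_cycle. rewrite chain_snoc. tauto. Qed.

Lemma is_cycle_rot E c v : is_cycle E c -> In v c ->
  exists l, is_cycle E (v :: l) /\ forall x, In x (v :: l) <-> In x c.
Proof.
  intros Hc Hv. apply in_split in Hv. destruct Hv as (a & b & ->).
  exists (b ++ a). split.
  - destruct a as [|x a]; simpl in Hc; [now rewrite app_nil_r|].
    apply is_cycle_closed in Hc as (Hl & Hn & Hch). apply is_cycle_closed.
    rewrite <- app_assoc in Hch. simpl in Hch. apply chain_mid in Hch as [H1 H2].
    assert (Hp : NoDup (v :: b ++ x :: a)).
    { revert Hn. apply Permutation_NoDup. apply (Permutation_app_comm (x :: a) (v :: b)). }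
    repeat split; auto.
    + simpl in *. rewrite length_app in *; simpl in *; lia.
    + rewrite <- app_assoc. simpl. apply chain_mid. auto.
  - intros x. simpl. rewrite !in_app_iff. simpl. tauto.
Qed.

Lemma is_cycle_rev E x l : symm E -> is_cycle E (x :: l) -> is_cycle E (x :: rev l).
Proof.
  intros HE. rewrite !is_cycle_closed. intros (Hl & Hn & Hc). repeat split.
  - simpl in *. now rewrite length_rev.
  - inversion Hn; subst. constructor; [now rewrite <- in_rev|]. now apply NoDup_rev.
  - now apply chain_rev.
Qed.

Lemma is_cycle_two_nbrs E c v : symm E -> is_cycle E c -> In v c ->
  exists p q, In p c /\ In q c /\ p <> q /\ E v p /\ E v q.
Proof.
  intros HE Hc Hv. destruct (is_cycle_rot E c v Hc Hv) as (l & Hl & Hi).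
  apply is_cycle_closed in Hl as (H3 & Hn & Hch). simpl in H3.
  destruct l as [|p l]; [simpl in H3; lia|].
  destruct (exists_last (l := l)) as (l' & q & ->).
  { intros ->; simpl in H3; lia. }
  exists p, q. inversion Hn as [|? ? Hnv Hn']; subst. inversion Hn' as [|? ? Hnp _]; subst.
  repeat split.
  - apply Hi; simpl; auto.
  - apply Hi; simpl; rewrite in_app_iff; simpl; auto.
  - intros ->; apply Hnp; rewrite in_app_iff; simpl; auto.
  - simpl in Hch; tauto.
  - simpl in Hch. destruct Hch as [_ Hch]. rewrite <- app_assoc in Hch. simpl in Hch.
    apply chain_mid in Hch. simpl in Hch. apply HE; tauto.
Qed.

(** Two of the at most three edges at [a] go to the cycle, which leaves one. This is the main use of
    the degree bound. *)
Lemma is_cycle_outer_nbr E c a x y : symm E -> subcubic E -> is_cycle E c -> In a c ->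
  ~ In x c -> ~ In y c -> E a x -> E a y -> x = y.
Proof.
  intros HE H3 Hc Ha Nx Ny Ex Ey. apply NNPP; intros Nxy.
  destruct (is_cycle_two_nbrs E c a HE Hc Ha) as (p & q & Hp & Hq & Hpq & Ep & Eq).
  assert (4 <= 3); [|lia]. apply (H3 a [p; q; x; y]).
  - repeat constructor; simpl; intuition congruence.
  - simpl; intuition; subst; auto.
Qed.

Lemma cycle_edge_sym (c : list V) u v : cycle_edge c u v -> cycle_edge c v u.
Proof.
  unfold cycle_edge, path_edge. intros [(l1 & l2 & H)|(x & l & H & H')].
  - left; exists l1, l2; tauto.
  - right; exists x, l; tauto.
Qed.

Lemma cycle_edge_in (c : list V) u v : cycle_edge c u v -> In u c /\ In v c.
Proof.
  intros [(l1 & l2 & [-> | ->])|(x & l & -> & H)].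
  1,2: rewrite !in_app_iff; simpl; tauto.
  assert (H' : In (last l x) (x :: l)).
  { clear. revert x; induction l as [|a l IH]; intros x; [simpl; auto|].
    rewrite last_cons. right; apply IH. }
  simpl in *. destruct H as [[-> ->]|[-> ->]]; auto.
Qed.

Lemma is_cycle_edge E c u v : symm E -> is_cycle E c -> cycle_edge c u v -> E u v.
Proof.
  intros HE Hc [(l1 & l2 & H)|(x & l & -> & H)].
  - destruct c as [|x l]; [contradiction|]. destruct Hc as (_ & _ & Hc & _).
    destruct H as [H|H]; [|apply HE]; eapply chain_edge; eauto.
  - destruct Hc as (_ & _ & _ & Hc). destruct H as [[-> ->]|[-> ->]]; auto.
Qed.

Lemma is_cycle_mono E E' c : (forall u v, E u v -> E' u v) -> is_cycle E c -> is_cycle E' c.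
Proof.
  intros H. destruct c; [auto|]. intros (H1 & H2 & H3 & H4). repeat split; auto.
  eapply chain_mono; eauto.
Qed.

Lemma cycle_connected E c : symm E -> (forall u v, cycle_edge c u v -> E u v) ->
  forall u v, In u c -> In v c -> walk E (fun x => In x c) u v.
Proof.
  intros HE Hc.
  assert (H : forall p r, c = r ++ p -> forall x, In x p -> forall y p', p = y :: p' ->
     walk E (fun x => In x c) y x).
  { induction p as [|a p IH]; intros r e x Hx y p' e'; [discriminate|].
    injection e' as <- <-.
    assert (Ha : In a c) by (subst c; rewrite in_app_iff; simpl; auto).
    destruct Hx as [->|Hx]; [constructor; auto|].
    destruct p as [|b p]; [contradiction|].
    eapply walk_step; [auto| |eapply (IH (r ++ [a]))]; eauto.
    - apply Hc. left. exists r, p. auto.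
    - rewrite e, <- app_assoc; reflexivity. }
  intros u v Hu Hv. destruct c as [|x c]; [contradiction|].
  apply walk_trans with x; [apply walk_sym; auto|]; apply (H (x :: c) []) with c; auto.
Qed.

End Walks.

(* Whitney's argument: a cycle through [k] and [v] is rerouted through a neighbour [u] of [v]; the
   ear that starts with the edge [v u] cannot return to [v] because [v] has degree at most 3. *)
Lemma bridgeless_cycle_through {V} (H : graph V) (K : V -> Prop) (k : V) :
  simple H -> subcubic H ->
  (forall u v, H u v -> walk (cut H u v) (fun _ => True) u v) ->
  forall u, walk H K u k -> u <> k -> exists c, is_cycle H c /\ In u c /\ In k c.
Proof.
  intros [Hs Hi] H3 Hb u W.
  induction W as [|u v k Ku Huv W IH]; intros Huk; [contradiction|].
  destruct (classic (v = k)) as [->|Hvk].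
  (* [u] is adjacent to [k]: a path avoiding the edge [u k] is closed by that edge. It has a third
     vertex, since the one-edge path was removed. *)
  - destruct (walk_path _ _ _ _ (Hb _ _ Huv)) as (l & Hc & Hl & Hn & _).
    exists (u :: l). split; [|split; [left; auto|]].
    + repeat split; auto.
      * destruct l as [|a [|b l]]; simpl in *; [congruence| |lia].
        subst a. destruct Hc as [[_ Hc] _]. tauto.
      * eapply chain_mono; [|exact Hc]. intros ? ? [? _]; auto.
      * rewrite Hl; auto.
    + assert (Hx : forall x, In (last l x) (x :: l)).
      { clear. induction l as [|a l IH]; intros x; [simpl; auto|].
        rewrite last_cons. right; apply IH. }
      rewrite <- Hl; apply Hx.
  - destruct (IH Hvk) as (c & Hc & Hvc & Hkc).
    destruct (classic (In u c)) as [Huc|Huc]; [exists c; auto|].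
    destruct (walk_hit _ _ (fun x => In x c) _ _ (Hb _ _ Huv) Huc Hvc)
      as (y & x & Wuy & Hyx & Hxc & _).
    assert (Hyc : ~ In y c) by (apply walk_in_r in Wuy; tauto).
    assert (Hxv : x <> v).
    { intros ->. destruct Hyx as (Hyv & N & _). apply N. split; auto.
      apply (is_cycle_outer_nbr H c v); auto. }
    destruct (walk_path _ _ _ _ Wuy) as (q & Hq & Hlq & Hnq & HKq).
    assert (Hchq : chain H u (q ++ [x])).
    { apply chain_snoc. split; [|rewrite Hlq; apply Hyx].
      eapply chain_mono; [|exact Hq]. intros ? ? [? _]; auto. }
    assert (HKq' : forall z, In z (u :: q) -> ~ In z c).
    { intros z Hz. rewrite Forall_forall in HKq. apply HKq in Hz. tauto. }
    (* The route from [v] through [u] and [q] to [x] replaces the arc from [v] to [x] that precedes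
       [k]. *)
    assert (Hmain : forall l, is_cycle H (v :: l) -> (forall z, In z (v :: l) <-> In z c) ->
      forall l1 l2, l = l1 ++ x :: l2 -> In k (x :: l2) ->
      exists c, is_cycle H c /\ In u c /\ In k c).
    { intros l Hcl Hlc l1 l2 -> Hk. exists (v :: u :: q ++ x :: l2). split; [|split].
      - apply is_cycle_closed in Hcl as (_ & Hnl & Hchl). apply is_cycle_closed.
        rewrite <- app_assoc in Hchl. simpl in Hchl. apply chain_mid in Hchl as [_ Hchl].
        repeat split.
        + simpl; rewrite length_app; simpl; lia.
        + assert (Hnx : NoDup (v :: x :: l2)).
          { inversion Hnl as [|? ? Hv1 Hn1]; subst. constructor.
            - rewrite in_app_iff in Hv1. tauto.
            - eapply NoDup_app_remove_l; eauto. }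
          inversion Hnx; subst.
          assert (Hsub : forall z, In z (x :: l2) -> In z c).
          { intros z Hz. apply Hlc. simpl; rewrite in_app_iff; simpl in *; tauto. }
          constructor.
          * change (~ In v ((u :: q) ++ x :: l2)). rewrite in_app_iff.
            intros [Hz|Hz]; [|auto]. apply (HKq' v); auto.
          * change (NoDup ((u :: q) ++ x :: l2)). apply NoDup_app; auto.
            intros z Hz Hz'. apply (HKq' z); auto.
        + simpl. auto.
        + change (chain H u ((q ++ x :: l2) ++ [v])). rewrite <- app_assoc.
          apply chain_mid; auto.
      - simpl; auto.
      - simpl; rewrite in_app_iff; auto. }
    destruct (is_cycle_rot H c v Hc Hvc) as (l & Hcl & Hlc).
    assert (Hxl : In x l) by (apply Hlc in Hxc as [->|]; tauto).
    assert (Hkl : In k l) by (apply Hlc in Hkc as [->|]; tauto).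
    apply in_split in Hxl as Hxl'. destruct Hxl' as (l1 & l2 & e).
    rewrite e in Hkl. apply in_app_iff in Hkl as [Hk|Hk]; [|eapply Hmain; eauto].
    (* Here [k] comes before [x], so the cycle is traversed backwards. *)
    apply (Hmain (rev l)) with (rev l2) (rev l1).
    + now apply is_cycle_rev.
    + intros z. rewrite <- Hlc. simpl. rewrite <- in_rev. tauto.
    + rewrite e, rev_app_distr. simpl. now rewrite <- app_assoc.
    + right. now rewrite <- in_rev.
Qed.

(* Loop erasure: the ray jumps to the last visit of the current vertex before moving on. *)
Lemma ray_of_walk {V} (E : graph V) (w : nat -> V) :
  (forall n, E (w n) (w (S n))) -> (forall x, exists N, forall n, N <= n -> w n <> x) ->
  exists r, is_ray E r /\ exists f, (forall i, i <= f i) /\ forall i, r i = w (f i).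
Proof.
  intros HE Hfin.
  assert (Hlast : forall n, exists m, n <= m /\ w m = w n /\ forall k, m < k -> w k <> w n).
  { intros n. destruct (Hfin (w n)) as (N & HN).
    assert (H : forall d m, N - m <= d -> n <= m -> w m = w n ->
      exists m, n <= m /\ w m = w n /\ forall k, m < k -> w k <> w n).
    { induction d as [|d IH]; intros m Hd Hm e.
      - exists m. repeat split; auto. intros k Hk. apply HN. lia.
      - destruct (classic (exists k, m < k /\ w k = w n)) as [(k & Hk & ek)|Nk].
        + apply (IH k); auto; lia.
        + exists m. repeat split; auto. intros k Hk ek. apply Nk; eauto. }
    apply (H (N - n) n); auto. }
  set (lst := fun n => epsilon (inhabits 0)
    (fun m => n <= m /\ w m = w n /\ forall k, m < k -> w k <> w n)).
  assert (Hl : forall n, n <= lst n /\ w (lst n) = w n /\ forall k, lst n < k -> w k <> w n).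
  { intros n. exact (epsilon_spec (inhabits 0) _ (Hlast n)). }
  clearbody lst.
  set (f := fix f i := match i with 0 => lst 0 | S j => lst (S (f j)) end).
  assert (Hf : forall i, f i < f (S i)) by (intros i; simpl; apply Hl).
  assert (Hmono : forall i j, i < j -> f i < f j).
  { intros i j Hij. induction Hij as [|j Hij IH]; auto. specialize (Hf j). lia. }
  assert (Hleave : forall i k, f i < k -> w k <> w (f i)).
  { intros i k. destruct i as [|i]; simpl.
    - destruct (Hl 0) as (_ & e & H). rewrite e. apply H.
    - destruct (Hl (S (f i))) as (_ & e & H). rewrite e. apply H. }
  exists (fun i => w (f i)). split; [split|exists f; split; auto].
  - intros m n e. destruct (lt_eq_lt_dec m n) as [[H|H]|H]; auto; exfalso.
    + apply (Hleave m (f n)); auto.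
    + apply (Hleave n (f m)); auto.
  - intros n. simpl. destruct (Hl (S (f n))) as (_ & e & _). rewrite e. apply HE.
  - induction i as [|i IH]; [lia|]. specialize (Hf i). lia.
Qed.

(** The walks are concatenated and loop-erased. A vertex is met finitely often because it lies
    outside some [U j]; [c j <> c (S j)] makes every segment nonempty, so the concatenation is
    infinite. *)
Lemma ray_from_walks {V} (E : graph V) (U : nat -> V -> Prop) (c : nat -> V) :
  (forall j, walk E (U j) (c j) (c (S j))) -> (forall j, c j <> c (S j)) ->
  (forall i j x, i <= j -> U j x -> U i x) -> (forall x, exists j, ~ U j x) ->
  exists r, is_ray E r /\ forall j, exists n, forall i, n <= i -> U j (r i).
Proof.
  intros HW Hne Hdec Hfin.
  assert (HL : forall j, exists l, chain E (c j) l /\ last l (c j) = c (S j) /\ Forall (U j) l /\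
    l <> []).
  { intros j. destruct (walk_path _ _ _ _ (HW j)) as (l & H1 & H2 & _ & H4).
    exists l. inversion H4; subst. repeat split; auto. intros ->. now apply (Hne j). }
  set (L := fun j => epsilon (inhabits []) (fun l => chain E (c j) l /\ last l (c j) = c (S j) /\
    Forall (U j) l /\ l <> [])).
  assert (HL' : forall j, chain E (c j) (L j) /\ last (L j) (c j) = c (S j) /\
    Forall (U j) (L j) /\ L j <> []) by (intros j; exact (epsilon_spec (inhabits []) _ (HL j))).
  clearbody L. clear HL.
  set (cat := fix cat n := match n with 0 => [] | S m => cat m ++ L m end).
  assert (Happ : forall x (l l' : list V), last (l ++ l') x = last l' (last l x)).
  { intros x l l'. revert x; induction l as [|a l IH]; intros x; [auto|].
    simpl app. now rewrite !last_cons. }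
  assert (Hchapp : forall x l l', chain E x l -> chain E (last l x) l' -> chain E x (l ++ l')).
  { intros x l l'. revert x; induction l as [|a l IH]; intros x H H'; [auto|].
    rewrite last_cons in H'. simpl. destruct H. auto. }
  assert (Hcat : forall n, chain E (c 0) (cat n) /\ last (cat n) (c 0) = c n /\ n <= length (cat n)).
  { induction n as [|n (H1 & H2 & H3)]; [simpl; auto|].
    destruct (HL' n) as (H4 & H5 & _ & H6). simpl. repeat split.
    - apply Hchapp; auto. now rewrite H2.
    - now rewrite Happ, H2.
    - rewrite length_app. destruct (L n); [congruence|]. simpl. lia. }
  assert (Hext : forall n m, n <= m -> exists l, cat m = cat n ++ l /\ Forall (U n) l).
  { intros n m H. induction H as [|m H (l & e & Hl)].
    - exists []. rewrite app_nil_r. auto.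
    - exists (l ++ L m). simpl. rewrite e, app_assoc. split; auto. apply Forall_app. split; auto.
      destruct (HL' m) as (_ & _ & Hm & _). eapply Forall_impl; [|exact Hm].
      intros a Ha. eapply Hdec; eauto. }
  set (w := fun n => nth n (c 0 :: cat n) (c 0)).
  (* The first [n] segments have at least [n] entries, so position [n] is never changed by later
     ones. *)
  assert (Hw : forall n m, n <= m -> w n = nth n (c 0 :: cat m) (c 0)).
  { intros n m H. destruct (Hext n m H) as (l & e & _). rewrite e. unfold w.
    change (c 0 :: cat n ++ l) with ((c 0 :: cat n) ++ l). rewrite app_nth1; auto.
    destruct (Hcat n) as (_ & _ & Hn). simpl; lia. }
  assert (HwE : forall n, E (w n) (w (S n))).
  { intros n. destruct (Hcat (S n)) as (Hc & _ & Hn).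
    rewrite (Hw n (S n)), (Hw (S n) (S n)) by lia.
    assert (Hin : n < length (c 0 :: cat (S n))) by (cbn [length]; lia).
    destruct (nth_split (c 0 :: cat (S n)) (c 0) Hin) as (l1 & l2 & e & Hl1).
    destruct l2 as [|y l2].
    { apply (f_equal (@length V)) in e. rewrite length_app in e. cbn [length] in e. lia. }
    assert (e2 : nth (S n) (c 0 :: cat (S n)) (c 0) = y).
    { rewrite e, app_nth2 by lia. replace (S n - length l1) with 1 by lia. reflexivity. }
    rewrite e2. eapply chain_edge; [exact Hc|exact e]. }
  assert (HwU : forall j, exists N, forall n, N <= n -> U j (w n)).
  { intros j. exists (S (length (cat j))). intros n Hn.
    destruct (Hcat j) as (_ & _ & Hj).
    destruct (Hext j n) as (l & e & Hl); [lia|].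
    destruct (Hcat n) as (_ & _ & Hn').
    destruct n as [|n]; [lia|]. unfold w. cbn [nth]. rewrite e in *. rewrite length_app in Hn'.
    rewrite app_nth2 by lia. rewrite Forall_forall in Hl. apply Hl, nth_In. lia. }
  destruct (ray_of_walk E w HwE) as (r & Hr & f & Hf & e).
  { intros x. destruct (Hfin x) as (j & Hj). destruct (HwU j) as (N & HN).
    exists N. intros n Hn ex. apply Hj. rewrite <- ex. auto. }
  exists r. split; auto. intros j. destruct (HwU j) as (N & HN). exists N. intros i Hi.
  rewrite e. apply HN. specialize (Hf i). lia.
Qed.

Lemma ray_avoids {V} (r : nat -> V) (l : list V) : (forall m n, r m = r n -> m = n) ->
  exists m, forall i, m <= i -> ~ In (r i) l.
Proof.
  intros Hr. induction l as [|x l (m & Hm)]; [exists 0; auto|].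
  destruct (classic (exists i, r i = x)) as [(i & Hi)|N].
  - exists (S (m + i)). intros j Hj [H|H]; [|apply (Hm j); auto; lia].
    rewrite <- Hi in H. apply Hr in H. lia.
  - exists m. intros j Hj [H|H]; [apply N; eauto|apply (Hm j); auto].
Qed.

Lemma ray_walk {V} (E : graph V) (K : V -> Prop) r m i : is_ray E r ->
  (forall j, K (r (m + j))) -> walk E K (r m) (r (m + i)).
Proof.
  intros [_ HE] HK. induction i as [|i IH].
  - rewrite Nat.add_0_r. constructor. specialize (HK 0). now rewrite Nat.add_0_r in HK.
  - apply walk_trans with (r (m + i)); auto. apply walk_edge; auto.
    rewrite Nat.add_succ_r. apply HE.
Qed.

(** * Edge-connectivity classes *)

(** Since [a] and [b] range over all pairs, and a non-edge removes nothing, connectivity within [K]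
    is included. *)
Definition ec {V} (G : graph V) (K : V -> Prop) (u v : V) : Prop :=
  forall a b, walk (cut G a b) K u v.

Definition outside {V} (G : graph V) (K : V -> Prop) (k x : V) : Prop := K x /\ ~ ec G K k x.

Section EdgeConnectivity.
Context {V : Type} (G : graph V) (G_sym : symm G).
Implicit Types (K : V -> Prop).

Lemma ec_in K u v : ec G K u v -> K v.
Proof. intros H; exact (walk_in_r _ _ _ _ (H u u)). Qed.

Lemma ec_refl K u : K u -> ec G K u u.
Proof. intros H a b; constructor; auto. Qed.

Lemma ec_sym K u v : ec G K u v -> ec G K v u.
Proof. intros H a b; apply walk_sym; auto using cut_symm. Qed.

Lemma ec_trans K u v w : ec G K u v -> ec G K v w -> ec G K u w.
Proof. intros H H' a b; eapply walk_trans; eauto. Qed.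

Lemma ec_edge K u v : K u -> K v -> G u v -> walk (cut G u v) K u v -> ec G K u v.
Proof.
  intros Ku Kv Guv W a b.
  destruct (classic (u = a /\ v = b)) as [[-> ->]|H1]; [auto|].
  destruct (classic (u = b /\ v = a)) as [[-> ->]|H2].
  - eapply walk_mono; [| |exact W]; auto using cut_comm.
  - apply walk_edge; auto. repeat split; auto.
Qed.

(** A second edge would give a detour around [b l]: through the class to [b'], across to [l'], and
    back to [l] outside. Then [b l] is no bridge and [l] belongs to the class. *)
Lemma gate_unique K k b l b' l' :
  ec G K k b -> ec G K k b' -> walk G (outside G K k) l l' -> G b l -> G b' l' ->
  b = b' /\ l = l'.
Proof.
  intros Hb Hb' W Gbl Gbl'. apply NNPP; intros Hne.
  assert (Hl : outside G K k l) by (eapply walk_in_l; eauto).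
  assert (Hl' : outside G K k l') by (eapply walk_in_r; eauto).
  pose proof (ec_in _ _ _ Hb) as Kb. pose proof (ec_in _ _ _ Hb') as Kb'.
  destruct Hl as [Kl Nl], Hl' as [Kl' Nl']. apply Nl.
  apply ec_trans with b; auto. apply ec_edge; auto.
  apply walk_trans with b'; [apply (ec_trans K b k b'); auto using ec_sym|].
  eapply walk_step; [auto| |].
  - repeat split; eauto; intros [e1 e2]; subst; tauto.
  - apply walk_sym; [now apply cut_symm|].
    eapply walk_mono; [| |exact W]; [intros ? [? _]; auto|].
    intros x y [_ Nx] [_ Ny] Gxy. repeat split; auto; intros [e1 e2]; subst; tauto.
Qed.

(* A walk that leaves the class returns through the gate it left by, so it can be shortened. *)
Lemma ec_project E K k x v : (forall x y, E x y -> G x y) ->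
  walk E K x v -> ec G K k v ->
  (ec G K k x -> walk E (ec G K k) x v) /\
  (~ ec G K k x -> exists b l, ec G K k b /\ G b l /\ walk G (outside G K k) x l /\
                               walk E (ec G K k) b v).
Proof.
  intros HE W; induction W as [v Kv|x y v Kx Exy W IH]; intros Hv.
  - split; [constructor; auto|contradiction].
  - destruct (IH Hv) as [IH1 IH2]. clear IH.
    assert (Ky : K y) by (eapply walk_in_l; eauto).
    destruct (classic (ec G K k y)) as [Hy|Hy].
    + specialize (IH1 Hy). split; intros Hx; [eapply walk_step; eauto|].
      exists y, x. repeat split; auto. constructor; split; auto.
    + destruct (IH2 Hy) as (b & l & Hb & Gbl & Wyl & Wb). split; intros Hx.
      * destruct (gate_unique K k x y b l) as [-> _]; auto.
      * exists b, l. repeat split; auto. eapply walk_step; eauto. split; auto.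
Qed.

(** The defining walks may leave the class; projected, they stay inside. So the class alone induces
    a bridgeless graph, as Whitney's argument requires. *)
Lemma ec_walk_inside K k u v a b :
  ec G K k u -> ec G K k v -> walk (cut G a b) (ec G K k) u v.
Proof.
  intros Hu Hv. apply (ec_project (cut G a b) K k u v); auto.
  - intros ? ? [? _]; auto.
  - apply (ec_trans K u k v); auto using ec_sym.
Qed.

(** The extra member [b] serves the case [w = k], where any cycle through [k] in the class will
    do. *)
Lemma ec_cycle_through K k w : simple G -> subcubic G ->
  ec G K k w -> (exists b, ec G K k b /\ b <> k) ->
  exists c, is_cycle G c /\ (forall x, In x c -> ec G K k x) /\ In k c /\ In w c.
Proof.
  intros GS G3 Hw (b & Hb & Hbk).
  set (H := fun x y => ec G K k x /\ ec G K k y /\ G x y).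
  assert (Hk : ec G K k k) by (apply (ec_trans _ _ b); auto using ec_sym).
  assert (Hmain : forall w, ec G K k w -> w <> k ->
    exists c, is_cycle G c /\ (forall x, In x c -> ec G K k x) /\ In k c /\ In w c).
  { clear w Hw. intros w Hw Hwk.
    destruct (bridgeless_cycle_through H (ec G K k) k) with (u := w) as (c & Hc & Hwc & Hkc); auto.
    - split; [intros u v (? & ? & ?); repeat split; auto|intros v (_ & _ & ?); eapply GS; eauto].
    - intros v l Hl Hv. apply (G3 v l Hl). intros u Hu. apply Hv; auto.
    - intros u v (Hu & Hv & Guv).
      eapply walk_mono; [| |apply (ec_walk_inside K k u v u v); auto]; auto.
      intros x y Hx Hy [Gxy N]. split; [repeat split; auto|auto].
    - eapply walk_mono; [| |apply (ec_walk_inside K k w k w w); auto]; auto.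
      intros x y Hx Hy [Gxy N]. repeat split; auto.
    - exists c. repeat split; auto.
      + eapply is_cycle_mono; [|exact Hc]. intros u v (_ & _ & ?); auto.
      + intros x Hx. destruct (is_cycle_two_nbrs H c x) as (p & _ & _ & _ & _ & Hp & _); auto.
        * intros u v (? & ? & ?); repeat split; auto.
        * apply Hp. }
  destruct (classic (w = k)) as [->|Hwk]; [|auto].
  destruct (Hmain b Hb Hbk) as (c & H1 & H2 & H3 & H4). exists c; auto.
Qed.

End EdgeConnectivity.

Lemma subcubic_nbrs {V} (G : graph V) : subcubic G ->
  exists nbr : V -> list V, forall v u, G v u <-> In u (nbr v).
Proof.
  intros G3.
  assert (H : forall v, exists l, forall u, G v u <-> In u l).
  { intros v.
    assert (H : forall n l, 3 - length l <= n -> NoDup l -> (forall u, In u l -> G v u) ->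
      exists l, forall u, G v u <-> In u l).
    { induction n as [|n IH]; intros l Hn Hl Hv.
      all: destruct (classic (exists u, G v u /\ ~ In u l)) as [(u & Gu & Nu)|N].
      2,4: exists l; intros u; split; auto; intros Gu; apply NNPP; intros Nu; apply N; eauto.
      all: assert (Hl' : NoDup (u :: l)) by (constructor; auto).
      all: assert (Hv' : forall x, In x (u :: l) -> G v x) by (intros x [->|Hx]; auto).
      all: pose proof (G3 v _ Hl' Hv') as H3; simpl in H3.
      - lia.
      - apply (IH (u :: l)); auto. cbn [length]. lia. }
    apply (H 3 []); [simpl; lia|constructor|contradiction]. }
  exists (fun v => epsilon (inhabits []) (fun l => forall u, G v u <-> In u l)).
  intros v. exact (epsilon_spec (inhabits []) _ (H v)).
Qed.

(** * Pieces *)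

(* [piece] is still to be spanned; it is entered through the edge from [tip] to [start], and some
   of its later parts from the cycle [anchor]. The chain of blocks from [start] leads to [target]. *)
Record state (V : Type) := mkState {
  piece : V -> Prop; anchor : list V; tip : V; start : V; target : V }.
Arguments mkState {V}. Arguments piece {V}. Arguments anchor {V}.
Arguments tip {V}. Arguments start {V}. Arguments target {V}.

Definition block {V} (G : graph V) (s : state V) : V -> Prop := ec G (piece s) (start s).
Definition beyond {V} (G : graph V) (s : state V) : V -> Prop := outside G (piece s) (start s).
Definition trivial {V} (G : graph V) (s : state V) : Prop :=
  forall v, block G s v -> v = start s.
Definition exit_of {V} (G : graph V) (s : state V) (w : V) : Prop :=
  block G s w /\ (w = target s \/ exists l, G w l /\ walk G (beyond G s) l (target s)).

(** The cycle is asked to meet every exit because none can be named here; [exit_unique] shows that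
    there is only one. The choice makes the cycle a function of the state. *)
Definition core {V} (G : graph V) (s : state V) : list V :=
  if excluded_middle_informative (trivial G s) then [start s]
  else epsilon (inhabits []) (fun c => is_cycle G c /\ (forall x, In x c -> block G s x) /\
         In (start s) c /\ forall w, exit_of G s w -> In w c).

Definition in_rest {V} (G : graph V) (s : state V) : V -> V -> Prop :=
  walk G (fun y => block G s y /\ ~ In y (core G s)).
Definition in_hang {V} (G : graph V) (s : state V) : V -> V -> Prop := walk G (beyond G s).

(** [v0] enters just through a proof of inhabitance, so by proof irrelevance it does not influence
    the edge. *)
Definition pick_edge {V} (G : graph V) (v0 : V) (P Q : V -> Prop) : V * V :=
  epsilon (inhabits (v0, v0)) (fun p => P (fst p) /\ Q (snd p) /\ G (fst p) (snd p)).

(* The state processed next for the vertices near [v]; by extensionality it depends only on the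
   set [in_rest s v] or [in_hang s v]. *)
Definition next_state {V} (G : graph V) (rank : V -> nat) (s : state V) (v : V) : state V :=
  if excluded_middle_informative (In v (core G s)) then s
  else if excluded_middle_informative (block G s v) then
    let L := in_rest G s v in
    let p := pick_edge G v (fun x => In x (core G s)) L in
    mkState L (core G s) (fst p) (snd p)
      (epsilon (inhabits v) (fun z => L z /\ forall y, L y -> rank z <= rank y))
  else
    let L := in_hang G s v in
    let g := pick_edge G v (block G s) L in
    if excluded_middle_informative (L (target s)) then
      mkState L (anchor s) (fst g) (snd g) (target s)
    else
      let p := pick_edge G v (fun x => In x (anchor s)) L in
      (* The new target is the end in [L] of the bridge to the block. A subset of [L] containing it
         may depend on this bridge as its second way out, and [inv_bridge] exempts exactly the
         subsets that contain the start or the target. *)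
      mkState L (anchor s) (fst p) (snd p) (snd g).

(** What the choices in [next_state] guarantee, without the choices. In [succ_hang], [b] and
    [target s'] are the ends of the bridge to the block. *)
Inductive succ {V} (G : graph V) (rank : V -> nat) (s : state V) (v : V) (s' : state V) : Prop :=
| succ_rest :
    block G s v -> piece s' = in_rest G s v -> anchor s' = core G s -> In (tip s') (anchor s') ->
    (forall y, piece s' y -> rank (target s') <= rank y) -> piece s' (target s') ->
    succ G rank s v s'
| succ_chain :
    ~ block G s v -> piece s' = in_hang G s v -> anchor s' = anchor s -> block G s (tip s') ->
    target s' = target s -> piece s' (target s') -> succ G rank s v s'
| succ_hang b :
    ~ block G s v -> piece s' = in_hang G s v -> anchor s' = anchor s -> In (tip s') (anchor s') ->
    ~ piece s' (target s) -> piece s' (target s') -> block G s b -> G b (target s') ->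
    succ G rank s v s'.

(* [inv_bridge]: a part attached to the rest of the piece by a single edge can be entered from the
   anchor, unless it contains the start or the target. *)
Record inv {V} (G : graph V) (s : state V) : Prop := {
  inv_start : piece s (start s);
  inv_target : piece s (target s);
  inv_conn : forall u v, piece s u -> piece s v -> walk G (piece s) u v;
  inv_bd : exists S, forall u v, piece s u -> ~ piece s v -> G u v -> In u S;
  inv_bridge : forall (Q : V -> Prop) b l, (exists q, Q q) -> (forall q, Q q -> piece s q) ->
    ~ Q (start s) -> ~ Q (target s) ->
    (forall q p, Q q -> piece s p -> ~ Q p -> G q p -> q = l /\ p = b) ->
    exists q a, Q q /\ In a (anchor s) /\ G q a;
  inv_anchor : forall a, In a (anchor s) -> ~ piece s a;
  inv_anchor_nbr : forall a u v, In a (anchor s) -> piece s u -> piece s v ->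
    G a u -> G a v -> u = v;
  (* Conditional, because the [tip] of the root is a placeholder; the empty anchor makes the
     condition vacuous there. *)
  inv_tip : In (tip s) (anchor s) -> G (tip s) (start s) }.

(** * The next piece and the preservation of the invariant *)

Section States.
Context {V : Type} (G : graph V) (G_simple : simple G) (G_sub : subcubic G).
Let G_sym : symm G := proj1 G_simple.

Lemma inv_exit s : inv G s -> exists w, exit_of G s w.
Proof.
  intros I. destruct (classic (block G s (target s))) as [H|H].
  - exists (target s); split; auto.
  - destruct (ec_project G G_sym G (piece s) (start s) (target s) (start s))
      as [_ Hp]; auto.
    + apply (inv_conn G s I); apply I.
    + apply ec_refl, I.
    + destruct (Hp H) as (b & l & Hb & Gbl & W & _).
      exists b; split; auto. right. exists l; split; auto. now apply walk_sym.
Qed.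

Lemma exit_unique s w w' : exit_of G s w -> exit_of G s w' -> w = w'.
Proof.
  intros [Hw [->|(l & Gl & W)]] [Hw' [->|(l' & Gl' & W')]]; auto.
  - apply walk_in_r in W' as [_ N]. contradiction.
  - apply walk_in_r in W as [_ N]. contradiction.
  - apply (gate_unique G G_sym (piece s) (start s) w l w' l'); auto.
    apply walk_trans with (target s); auto. now apply walk_sym.
Qed.

Lemma core_spec s : inv G s ->
  In (start s) (core G s) /\ (forall x, In x (core G s) -> block G s x) /\
  (forall w, exit_of G s w -> In w (core G s)) /\
  ((trivial G s /\ core G s = [start s]) \/ (~ trivial G s /\ is_cycle G (core G s))).
Proof.
  intros I. unfold core.
  destruct (excluded_middle_informative (trivial G s)) as [T|T].
  - repeat split; simpl; auto.
    + intros x [<-|[]]. apply ec_refl, I.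
    + intros w [Hw _]. left; symmetry; auto.
  - destruct (inv_exit s I) as [w Hw].
    assert (E : exists c, is_cycle G c /\ (forall x, In x c -> block G s x) /\
         In (start s) c /\ forall w, exit_of G s w -> In w c).
    { destruct (ec_cycle_through G G_sym (piece s) (start s) w) as (c & H1 & H2 & H3 & H4); auto.
      - apply Hw.
      - apply NNPP; intros N; apply T; intros v Hv. apply NNPP; intros N'; apply N; eauto.
      - exists c. repeat split; auto. intros w' Hw'. now rewrite (exit_unique s w' w). }
    apply (epsilon_spec (inhabits [])) in E. tauto.
Qed.


Context (rank : V -> nat).

Lemma next_eq s u v : piece (next_state G rank s v) u -> ~ In u (core G s) -> ~ In v (core G s) ->
  next_state G rank s u = next_state G rank s v.
Proof.
  unfold next_state. intros Hu Nu Nv.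
  assert (Hext : forall K, walk G K v u -> walk G K u = walk G K v).
  { clear - G_sym. intros K W. apply functional_extensionality; intros x.
    apply propositional_extensionality.
    split; intros; eapply walk_trans; eauto. now apply walk_sym. }
  assert (Hpick : forall P Q, pick_edge G u P Q = pick_edge G v P Q).
  { intros P Q. unfold pick_edge. f_equal. apply proof_irrelevance. }
  destruct (excluded_middle_informative (In v (core G s))) as [|_]; [contradiction|].
  destruct (excluded_middle_informative (In u (core G s))) as [|_]; [contradiction|].
  destruct (excluded_middle_informative (block G s v)) as [Hv|Hv].
  - simpl in Hu. destruct (excluded_middle_informative (block G s u)) as [_|N].
    2: { apply walk_in_r in Hu. tauto. }
    unfold in_rest in *. rewrite (Hext _ Hu), Hpick. f_equal.
    f_equal. apply proof_irrelevance.
  - assert (Hu' : in_hang G s v u).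
    { destruct (excluded_middle_informative (in_hang G s v (target s))); exact Hu. }
    destruct (excluded_middle_informative (block G s u)) as [N|_].
    { apply walk_in_r in Hu' as [_ ?]. contradiction. }
    unfold in_hang in *. now rewrite (Hext _ Hu'), !Hpick.
Qed.

Lemma pick_edge_spec v0 (P Q : V -> Prop) : (exists x y, P x /\ Q y /\ G x y) ->
  let p := pick_edge G v0 P Q in P (fst p) /\ Q (snd p) /\ G (fst p) (snd p).
Proof.
  intros (x & y & H). apply (epsilon_spec (inhabits (v0, v0))
    (fun p => P (fst p) /\ Q (snd p) /\ G (fst p) (snd p))).
  exists (x, y); auto.
Qed.

Lemma rank_min (L : V -> Prop) v : L v -> exists z, L z /\ forall y, L y -> rank z <= rank y.
Proof.
  remember (rank v) as n eqn:e. revert v e.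
  induction n as [n IH] using lt_wf_ind. intros v -> Lv.
  destruct (classic (exists y, L y /\ rank y < rank v)) as [(y & Ly & Hy)|N].
  - apply (IH _ Hy y); auto.
  - exists v. split; auto. intros y Ly. apply Nat.nlt_ge. intros Hy. apply N; eauto.
Qed.

Lemma hang_gate s v : inv G s -> piece s v -> ~ block G s v ->
  exists b l, block G s b /\ G b l /\ in_hang G s v l.
Proof.
  intros I Hv Nv.
  destruct (ec_project G G_sym G (piece s) (start s) v (start s)) as [_ Hp]; auto.
  - apply I; auto; apply I.
  - apply ec_refl, I.
  - destruct (Hp Nv) as (b & l & Hb & Gbl & W & _). exists b, l. auto.
Qed.

Lemma hang_gate_unique s v b l b' l' : block G s b -> block G s b' ->
  in_hang G s v l -> in_hang G s v l' -> G b l -> G b' l' -> b = b' /\ l = l'.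
Proof.
  intros Hb Hb' Hl Hl'. apply (gate_unique G G_sym (piece s) (start s)); auto.
  apply walk_trans with v; auto. now apply walk_sym.
Qed.

Lemma hang_leaves s v q p : in_hang G s v q -> piece s p -> ~ in_hang G s v p -> G q p ->
  block G s p.
Proof.
  intros Hq Hp Np Gqp. apply NNPP; intros Nb. apply Np.
  eapply walk_trans; [exact Hq|]. apply walk_edge; auto.
  - exact (walk_in_r _ _ _ _ Hq).
  - split; auto.
Qed.

(** [inv_bridge] applies to the whole component: its only edge to the rest of the piece is its gate,
    and the start lies in the block. *)
Lemma hang_anchor s v : inv G s -> piece s v -> ~ block G s v -> ~ in_hang G s v (target s) ->
  exists q a, in_hang G s v q /\ In a (anchor s) /\ G q a.
Proof.
  intros I Hv Nv Nt.
  destruct (hang_gate s v I Hv Nv) as (b & l & Hb & Gbl & Hl).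
  apply (inv_bridge G s I (in_hang G s v) b l); auto.
  - eauto.
  - intros q Hq. apply walk_in_r in Hq. apply Hq.
  - intros Hq. apply walk_in_r in Hq. apply Hq. apply ec_refl, I.
  - intros q p Hq Hp Np Gqp. pose proof (hang_leaves s v q p Hq Hp Np Gqp) as Hpb.
    destruct (hang_gate_unique s v b l p q); auto.
Qed.

Lemma rest_core s v : inv G s -> block G s v -> ~ In v (core G s) ->
  exists x y, In x (core G s) /\ in_rest G s v y /\ G x y.
Proof.
  intros I Hv Nv. apply core_spec in I as C. destruct C as (Cs & Cb & _).
  assert (W : walk G (block G s) v (start s)).
  { eapply walk_mono; [| |apply (ec_walk_inside G G_sym (piece s) (start s) v (start s) v v)]; auto.
    - intros ? ? _ _ [? _]; auto.
    - apply ec_refl, I. }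
  destruct (walk_exit G _ (in_rest G s v) v (start s) W) as (x & y & Hx & Ny & Bx & By & Gxy).
  - constructor; auto.
  - intros N. apply walk_in_r in N. tauto.
  - exists y, x. repeat split; auto. apply NNPP; intros Nc. apply Ny.
    eapply walk_trans; [exact Hx|]. apply walk_edge; auto. exact (walk_in_r _ _ _ _ Hx).
Qed.

Lemma next_succ s v : inv G s -> piece s v -> ~ In v (core G s) ->
  let s' := next_state G rank s v in
  succ G rank s v s' /\ piece s' (start s') /\ G (tip s') (start s').
Proof.
  intros I Hv Nv. unfold next_state.
  destruct (excluded_middle_informative (In v (core G s))) as [|_]; [contradiction|].
  destruct (excluded_middle_informative (block G s v)) as [Hb|Hb].
  - pose proof (pick_edge_spec v (fun x => In x (core G s)) _ (rest_core s v I Hb Nv)) as Hp.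
    pose proof (epsilon_spec (inhabits v) _
      (rank_min (in_rest G s v) v (walk_refl _ _ v (conj Hb Nv)))) as Hz.
    simpl in Hp. cbv beta in Hz. split; [|simpl; tauto]. apply succ_rest; simpl; tauto.
  - pose proof (pick_edge_spec v (block G s) (in_hang G s v)) as Hg.
    destruct (hang_gate s v I Hv Hb) as (b & l & Hbb & Gbl & Hl).
    specialize (Hg (ex_intro _ b (ex_intro _ l (conj Hbb (conj Hl Gbl))))). simpl in Hg.
    destruct (excluded_middle_informative (in_hang G s v (target s))) as [Ht|Ht].
    + split; [|simpl; tauto]. apply succ_chain; simpl; tauto.
    + pose proof (pick_edge_spec v (fun x => In x (anchor s)) (in_hang G s v)) as Hp.
      destruct (hang_anchor s v I Hv Hb Ht) as (q & a & Hq & Ha & Gqa).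
      specialize (Hp (ex_intro _ a (ex_intro _ q (conj Ha (conj Hq (G_sym _ _ Gqa)))))).
      simpl in Hp.
      split; [|simpl; tauto].
      apply (succ_hang _ _ _ _ _ (fst (pick_edge G v (block G s) (in_hang G s v)))); simpl; tauto.
Qed.

Lemma succ_piece s v s' : succ G rank s v s' -> inv G s -> piece s v -> ~ In v (core G s) ->
  piece s' v /\ (forall x, piece s' x -> piece s x /\ ~ In x (core G s)).
Proof.
  intros S I Hv Nv. pose proof (core_spec s I) as (_ & Cb & _).
  destruct S as [Hb e _ _ _ _|Hb e _ _ _ _|b Hb e _ _ _ _ _ _]; rewrite e.
  - split; [constructor; auto|]. intros x Hx. apply walk_in_r in Hx as [H1 H2].
    split; auto. eapply ec_in; eauto.
  - split; [constructor; split; auto|]. intros x Hx. apply walk_in_r in Hx as [H1 H2].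
    split; auto. intros Cx; apply H2, Cb, Cx.
  - split; [constructor; split; auto|]. intros x Hx. apply walk_in_r in Hx as [H1 H2].
    split; auto. intros Cx; apply H2, Cb, Cx.
Qed.

(** One finite set serves all successor pieces at once. An edge leaving one of them leaves the old
    piece, meets the core, or is a gate. Each hanging component contains the target or, by
    [hang_anchor], a boundary vertex of the old piece, so there are finitely many gates. *)
Lemma succ_boundary s : inv G s -> exists S, forall u v, piece s u -> ~ In u (core G s) ->
  G u v -> ~ piece (next_state G rank s u) v -> In u S.
Proof.
  intros I. destruct (inv_bd G s I) as (S0 & HS0).
  destruct (subcubic_nbrs G G_sub) as (nbr & Hnbr).
  set (g := fun x => pick_edge G x (block G s) (in_hang G s x)).
  set (gl := map g (target s :: S0)).
  assert (Hgl : forall b l, block G s b -> beyond G s l -> G b l -> In (b, l) gl).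
  { intros b l Hb [Kl Nl] Gbl.
    assert (Hx : exists x, In x (target s :: S0) /\ in_hang G s l x).
    { destruct (classic (in_hang G s l (target s))) as [Ht|Ht].
      - exists (target s); simpl; auto.
      - destruct (hang_anchor s l I Kl Nl Ht) as (q & a & Hq & Ha & Gqa).
        exists q. split; auto. right. apply (HS0 q a); auto.
        + apply walk_in_r in Hq. apply Hq.
        + now apply (inv_anchor G s I). }
    destruct Hx as (x & Hx & Wx). apply in_map_iff. exists x. split; auto.
    assert (Wl : in_hang G s x l) by now apply walk_sym.
    pose proof (pick_edge_spec x (block G s) (in_hang G s x)
      (ex_intro _ b (ex_intro _ l (conj Hb (conj Wl Gbl))))) as (H1 & H2 & H3).
    fold (g x) in H1, H2, H3. destruct (g x) as [b' l']; simpl in *.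
    destruct (hang_gate_unique s x b' l' b l) as [-> ->]; auto. }
  exists (S0 ++ flat_map nbr (core G s) ++ map fst gl ++ map snd gl).
  intros u v Hu Nu Guv Nv. rewrite !in_app_iff.
  destruct (classic (piece s v)) as [Kv|Kv]; [|left; apply (HS0 u v); auto]. right.
  destruct (classic (In v (core G s))) as [Cv|Cv].
  { left. apply in_flat_map. exists v. split; auto. apply Hnbr; auto. }
  right. destruct (next_succ s u I Hu Nu) as [S _].
  assert (Hcase : (block G s u /\ beyond G s v) \/ (beyond G s u /\ block G s v)).
  { destruct S as [Hb e _ _ _ _|Hb e _ _ _ _|b Hb e _ _ _ _ _ _]; rewrite e in Nv.
    - left. split; auto. split; auto. intros Bv. apply Nv. apply walk_edge; auto.
    - right. split; [split; auto|]. apply NNPP; intros Bv. apply Nv. apply walk_edge; auto; split; auto.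
    - right. split; [split; auto|]. apply NNPP; intros Bv. apply Nv. apply walk_edge; auto; split; auto. }
  destruct Hcase as [[H1 H2]|[H1 H2]].
  - left. apply in_map_iff. exists (u, v). split; auto.
  - right. apply in_map_iff. exists (v, u). split; auto.
Qed.

(** The substantial clause is [inv_bridge]. Pieces inside the block get it from edge-connectivity of
    the block, hanging pieces from the old invariant. *)
Lemma succ_inv s v : inv G s -> piece s v -> ~ In v (core G s) -> inv G (next_state G rank s v).
Proof.
  intros I Hv Nv. destruct (next_succ s v I Hv Nv) as (S & Hst & Gtip).
  destruct (succ_piece _ _ _ S I Hv Nv) as (Hv' & Hsub).
  destruct (core_spec s I) as (Cs & Cb & _ & Cc).
  constructor; auto.
  - destruct S; auto.
  - assert (H : forall K, piece (next_state G rank s v) = walk G K v ->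
      forall x y, piece (next_state G rank s v) x -> piece (next_state G rank s v) y ->
      walk G (piece (next_state G rank s v)) x y).
    { intros K ->. intros x y Hx Hy. apply walk_trans with v; [apply walk_sym; auto|];
      now apply walk_in_component. }
    destruct S as [_ e _ _ _ _|_ e _ _ _ _|b _ e _ _ _ _ _ _]; eapply H; exact e.
  - destruct (succ_boundary s I) as (T & HT). exists T. intros u x Hu Nx Gux.
    destruct (Hsub u Hu) as [Ku Cu]. apply (HT u x); auto.
    now rewrite (next_eq s u v).
  - intros Q b l Hne HQ Ns Nt Hbr.
    (* In the old piece, too, [Q] has at most one edge to the rest: the bridge to the block ends
       outside [Q], at the new start or the new target. *)
    assert (Hhang : piece (next_state G rank s v) = in_hang G s v -> ~ block G s v ->
      ~ Q (target s) -> anchor (next_state G rank s v) = anchor s ->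
      (exists b l, block G s b /\ in_hang G s v l /\ G b l /\ ~ Q l) ->
      exists q a, Q q /\ In a (anchor (next_state G rank s v)) /\ G q a).
    { intros e Nb NQt eA (b0 & l0 & Hb0 & Hl0 & Gb0 & Nl0). rewrite eA.
      apply (inv_bridge G s I Q b l); auto.
      - intros q Hq. apply Hsub; auto.
      - intros Hq. apply HQ, Hsub in Hq. tauto.
      - intros q p Hq Hp Np Gqp.
        destruct (classic (piece (next_state G rank s v) p)) as [Hp'|Hp']; [auto|].
        exfalso. apply HQ in Hq as Hq'. rewrite e in Hp', Hq'.
        pose proof (hang_leaves s v q p Hq' Hp Hp' Gqp) as Hpb.
        destruct (hang_gate_unique s v p q b0 l0) as [_ ->]; auto. }
    destruct S as [Hb e eA Ht _ _|Hb e eA Ht et Ht'|b0 Hb e eA Ht Nt' Ht' Hb0 Gb0].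
    (* A walk in the block from [Q] to the new start that avoids the edge [l b] must leave [Q] by
       another edge, which can only lead to the core, the new anchor. *)
    + rewrite eA. apply NNPP; intros Nex. destruct Hne as (q & Hq).
      assert (Hqb : forall x, piece (next_state G rank s v) x -> block G s x /\ ~ In x (core G s)).
      { intros x Hx. rewrite e in Hx. now apply walk_in_r in Hx. }
      pose proof (ec_walk_inside G G_sym (piece s) (start s) q (start (next_state G rank s v)) l b)
        as W.
      destruct (walk_exit _ _ Q _ _ (W (proj1 (Hqb _ (HQ _ Hq))) (proj1 (Hqb _ Hst))) Hq Ns)
        as (x & y & Qx & Ny & Bx & By & Gxy & Nxy & _).
      destruct (classic (In y (core G s))) as [Cy|Cy]; [apply Nex; eauto|].
      assert (Ky : piece (next_state G rank s v) y).
      { apply HQ in Qx as Kx. rewrite e in Kx |- *.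
        eapply walk_trans; [exact Kx|]. apply walk_edge; auto. }
      destruct (Hbr x y Qx Ky Ny Gxy). tauto.
    + apply Hhang; auto.
      * now rewrite <- et.
      * exists (tip (next_state G rank s v)), (start (next_state G rank s v)).
        rewrite <- e. auto.
    + apply Hhang; auto.
      exists b0, (target (next_state G rank s v)). rewrite <- e. auto.
  - intros a Ha Ka.
    destruct S as [Hb e eA _ _ _|Hb e eA _ _ _|b Hb e eA _ _ _ _ _]; rewrite eA in Ha.
    + apply Hsub in Ka. tauto.
    + apply (inv_anchor G s I a); auto. now apply Hsub.
    + apply (inv_anchor G s I a); auto. now apply Hsub.
  - intros a x y Ha Hx Hy Gx Gy.
    destruct (Hsub x Hx) as [Kx Cx], (Hsub y Hy) as [Ky Cy].
    destruct S as [Hb e eA _ _ _|Hb e eA _ _ _|b Hb e eA _ _ _ _ _]; rewrite eA in Ha.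
    2,3: apply (inv_anchor_nbr G s I a); auto.
    destruct Cc as [[T _]|[_ Hc]]; [apply T in Hb; congruence|].
    apply (is_cycle_outer_nbr G (core G s) a); auto.
Qed.

End States.

(** * Progress *)

Definition count {V} (P : V -> Prop) (l : list V) : nat :=
  length (filter (fun x => if excluded_middle_informative (P x) then true else false) l).

Lemma count_le {V} (P Q : V -> Prop) l : (forall x, In x l -> Q x -> P x) ->
  count Q l <= count P l.
Proof.
  unfold count. induction l as [|x l IH]; intros H; [auto|]. simpl.
  assert (IH' : forall y, In y l -> Q y -> P y) by (intros; apply H; simpl; auto).
  specialize (IH IH').
  destruct (excluded_middle_informative (Q x)) as [q|q],
    (excluded_middle_informative (P x)) as [p|p]; simpl; try lia.
  exfalso. apply p, H; simpl; auto.
Qed.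

Lemma count_lt {V} (P Q : V -> Prop) l x : (forall x, In x l -> Q x -> P x) ->
  In x l -> P x -> ~ Q x -> count Q l < count P l.
Proof.
  intros H Hx Px Qx. apply in_split in Hx as (l1 & l2 & ->).
  assert (H1 : count Q l1 <= count P l1) by (apply count_le; intros; apply H; auto; rewrite in_app_iff; auto).
  assert (H2 : count Q l2 <= count P l2) by (apply count_le; intros; apply H; auto; rewrite in_app_iff; simpl; auto).
  unfold count in *. rewrite !filter_app, !length_app. simpl.
  destruct (excluded_middle_informative (Q x)), (excluded_middle_informative (P x)); simpl;
    tauto || lia.
Qed.

(** Counts the anchor vertices from which a part may still be entered. A tip on the anchor has
    already spent its one edge into the piece. *)
Definition live_anchors {V} (G : graph V) (s : state V) : nat :=
  count (fun a => a <> tip s /\ exists u, piece s u /\ G a u) (anchor s).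

Definition target_path {V} (G : graph V) (s : state V) (l : list V) : Prop :=
  chain G (start s) l /\ Forall (piece s) (start s :: l) /\ last l (start s) = target s.

Section Progress.
Context {V : Type} (G : graph V) (G_simple : simple G) (G_sub : subcubic G) (rank : V -> nat).
Let G_sym : symm G := proj1 G_simple.

Lemma target_path_ex s : inv G s -> exists l, target_path G s l.
Proof.
  intros I.
  destruct (walk_path G (piece s) (start s) (target s)) as (l & H1 & H2 & _ & H3).
  - apply I; apply I.
  - exists l. repeat split; auto.
Qed.

(** Behind the last vertex of the path outside the component only a shorter path within the
    component remains; that last vertex lies in the block. *)
Lemma hang_path s v z l : forall x, chain G x l -> Forall (piece s) (x :: l) -> last l x = z ->
  in_hang G s v z ->
  Forall (in_hang G s v) (x :: l) \/
  exists b l0 l', block G s b /\ G b l0 /\ chain G l0 l' /\ Forall (in_hang G s v) (l0 :: l') /\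
    last l' l0 = z /\ length l' < length l.
Proof.
  induction l as [|y l IH]; intros x Hc HK Hl Hz.
  - simpl in Hl. subst z. left; constructor; auto.
  - rewrite last_cons in Hl. destruct Hc as [Gxy Hc]. inversion HK as [|? ? Kx HK']; subst.
    destruct (IH y Hc HK' eq_refl Hz) as [H|(b & l0 & l' & H1 & H2 & H3 & H4 & H5 & H6)].
    + inversion H as [|? ? Hy _]; subst.
      destruct (classic (block G s x)) as [Bx|Bx].
      * right. exists x, y, l. simpl; repeat split; auto.
      * left. constructor; auto. eapply walk_trans; [exact Hy|].
        apply walk_edge; auto; [exact (walk_in_r _ _ _ _ Hy)|split; auto].
    + right. exists b, l0, l'. simpl; repeat split; auto.
Qed.

Lemma succ_chain_path s v s' l : inv G s -> succ G rank s v s' -> G (tip s') (start s') ->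
  piece s' (start s') -> ~ block G s v -> piece s' (target s) -> target_path G s l ->
  exists l', target_path G s' l' /\ length l' < length l.
Proof.
  intros I S Gt Hst Nb Ht (H1 & H2 & H3).
  destruct S as [Hb _ _ _ _ _|_ e _ Bt et _|b _ _ _ _ Nt _ _ _]; try contradiction.
  rewrite e in Ht, Hst.
  destruct (hang_path s v (target s) l (start s) H1 H2 H3 Ht) as [H|(b & l0 & l' & Hb & Gb & Hc & HF & Hl & Hlt)].
  - inversion H as [|? ? Hx _]; subst. apply walk_in_r in Hx as [_ N].
    exfalso. apply N, ec_refl, I.
  - inversion HF as [|? ? Hl0 _]; subst.
    destruct (hang_gate_unique G G_simple s v b l0 (tip s') (start s')) as [-> ->]; auto.
    exists l'. split; auto. unfold target_path. rewrite e, et. auto.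
Qed.

(** The old tip stays dead: its one neighbour in the old piece is [start s], now in the core. When a
    part is entered from the anchor, the new tip was live and is no longer counted. *)
Lemma succ_live_anchors s v s' : inv G s -> piece s v -> ~ In v (core G s) -> succ G rank s v s' ->
  G (tip s') (start s') -> piece s' (start s') -> ~ block G s v ->
  live_anchors G s' <= live_anchors G s /\
  (~ piece s' (target s) -> live_anchors G s' < live_anchors G s).
Proof.
  intros I Hv Nv S Gt Hst Nb.
  destruct (succ_piece G G_simple G_sub rank s v s' S I Hv Nv) as [_ Hsub].
  destruct (core_spec G G_simple G_sub s I) as (Cs & _).
  assert (Htip : forall a u, In a (anchor s) -> piece s' u -> G a u -> a <> tip s).
  { intros a u Ha Hu Gau ->. apply Hsub in Hu as [Ku Cu].
    apply Cu. replace u with (start s); auto.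
    apply (inv_anchor_nbr G s I (tip s)); auto; apply I; auto. }
  assert (HA : anchor s' = anchor s) by (destruct S; tauto).
  unfold live_anchors. rewrite HA.
  assert (Hle : forall a, In a (anchor s) -> a <> tip s' /\ (exists u, piece s' u /\ G a u) ->
     a <> tip s /\ (exists u, piece s u /\ G a u)).
  { intros a Ha (Na & u & Hu & Gu). split; [eapply Htip; eauto|].
    exists u. split; auto. now apply Hsub. }
  split; [now apply count_le|]. intros Nt.
  destruct S as [Hb _ _ _ _ _|_ e _ Bt et Pt|b _ _ _ Ht _ _ _ _]; try contradiction.
  { rewrite <- et in Nt. contradiction. }
  rewrite HA in Ht. apply count_lt with (tip s'); auto; [|tauto].
  split; [eapply Htip; eauto|]. exists (start s'). split; auto. now apply Hsub.
Qed.

(** Otherwise the pair of [live_anchors] and the length of a path from start to target would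
    decrease lexicographically forever. The vertices [w i] may vary, so that the lemma serves a
    single vertex as well as a ray. *)
Lemma rest_often (R : nat -> state V) (w : nat -> V) :
  (forall i, inv G (R i) /\ piece (R i) (w i) /\ ~ In (w i) (core G (R i)) /\
             R (S i) = next_state G rank (R i) (w i)) ->
  forall n, exists m, n <= m /\ block G (R m) (w m).
Proof.
  intros HR n. apply NNPP; intros N.
  assert (Hno : forall m, n <= m -> ~ block G (R m) (w m)) by (intros m Hm Hb; apply N; eauto).
  assert (H : forall c d i l, n <= i -> live_anchors G (R i) = c -> target_path G (R i) l ->
     length l = d -> False).
  { induction c as [c IHc] using lt_wf_ind. induction d as [d IHd] using lt_wf_ind.
    intros i l Hi Hc Hl Hd. specialize (Hno i Hi).
    destruct (HR i) as (I & Hv & Nv & e).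
    destruct (next_succ G G_simple G_sub rank (R i) (w i) I Hv Nv) as (S & Hst & Gt).
    rewrite <- e in S, Hst, Gt.
    destruct (succ_live_anchors (R i) (w i) (R (Datatypes.S i)) I Hv Nv S Gt Hst Hno) as [H1 H2].
    destruct (target_path_ex (R (Datatypes.S i))) as (l1 & Hl1); [apply HR|].
    destruct (Nat.lt_ge_cases (live_anchors G (R (Datatypes.S i))) c) as [Hlt|Hge].
    - eapply (IHc _ Hlt _ (Datatypes.S i) l1); eauto.
    - assert (Ht : piece (R (Datatypes.S i)) (target (R i))).
      { apply NNPP; intros Nt. apply H2 in Nt. lia. }
      destruct (succ_chain_path (R i) (w i) (R (Datatypes.S i)) l) as (l' & Hl' & Hlt); auto.
      rewrite Hd in Hlt. apply (IHd _ Hlt (Datatypes.S i) l'); auto. lia. }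
  destruct (target_path_ex (R n)) as (l & Hl); [apply HR|].
  eapply (H _ _ n l); eauto.
Qed.

(** A piece inside the block misses the target, because a target in the block is its own exit and
    lies in the core. A part entered from the anchor misses it by definition. *)
Lemma succ_target s v s' : inv G s -> succ G rank s v s' -> piece s' (target s) ->
  ~ block G s v /\ target s' = target s.
Proof.
  intros I S Ht.
  destruct S as [Hb e _ _ _ _|Hb _ _ _ et _|b _ _ _ _ Nt _ _ _]; auto; [exfalso|contradiction].
  rewrite e in Ht. apply walk_in_r in Ht as [Bt Nt]. apply Nt.
  apply (core_spec G G_simple G_sub s I). split; auto.
Qed.

(** * States reached from the root *)

Context (v0 : V) (G_conn : forall u v, walk G (fun _ => True) u v)
  (G_bridgeless : forall u v, G u v -> walk (cut G u v) (fun _ => True) u v).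

Definition root : state V := mkState (fun _ => True) [] v0 v0 v0.

(** As the anchor is empty, [inv_bridge] says that no set [Q] of the described kind exists, which is
    connectedness and bridgelessness of [G]. *)
Lemma root_inv : inv G root.
Proof.
  constructor; simpl; auto; try contradiction.
  - exists []; intros; tauto.
  - intros Q b l (q & Qq) _ Ns _ Hbr. exfalso.
    destruct (walk_exit _ _ Q _ _ (G_conn q v0) Qq Ns) as (x & y & Qx & Ny & _ & _ & Gxy).
    destruct (Hbr x y Qx I Ny Gxy) as [-> ->].
    destruct (walk_exit _ _ Q _ _ (G_bridgeless _ _ Gxy) Qx Ny)
      as (x & y & Qx' & Ny' & _ & _ & Gxy' & N & _).
    apply N. auto.
Qed.

(** The history of the piece around [v], computed for [v] alone; [st_eq] shows that vertices of one
    piece share it. *)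
Fixpoint st (v : V) (n : nat) : state V :=
  match n with
  | 0 => root
  | S m => next_state G rank (st v m) v
  end.

(** After [v] is spanned its state is frozen, so [st v n] describes stage [n] only under this
    condition. *)
Definition active (n : nat) (v : V) : Prop := forall m, m < n -> ~ In v (core G (st v m)).

Lemma next_stuck s v : In v (core G s) -> next_state G rank s v = s.
Proof.
  intros H. unfold next_state.
  destruct (excluded_middle_informative (In v (core G s))); [auto|contradiction].
Qed.

Lemma st_inv v n : inv G (st v n) /\ piece (st v n) v.
Proof.
  induction n as [|n [I Hv]]; [split; [apply root_inv|exact Logic.I]|]. simpl.
  destruct (classic (In v (core G (st v n)))) as [Hc|Hc]; [now rewrite next_stuck|].
  split; [now apply succ_inv|].
  apply (succ_piece G G_simple G_sub rank (st v n) v); auto. now apply next_succ.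
Qed.

Lemma st_succ v n : ~ In v (core G (st v n)) ->
  succ G rank (st v n) v (st v (S n)) /\ piece (st v (S n)) (start (st v (S n))) /\
  G (tip (st v (S n))) (start (st v (S n))).
Proof. destruct (st_inv v n). now apply next_succ. Qed.

Lemma st_sub v n : ~ In v (core G (st v n)) ->
  forall x, piece (st v (S n)) x -> piece (st v n) x /\ ~ In x (core G (st v n)).
Proof.
  intros Nv. destruct (st_inv v n).
  apply (succ_piece G G_simple G_sub rank (st v n) v); auto. now apply st_succ.
Qed.

Lemma active_S n v : active (S n) v <-> active n v /\ ~ In v (core G (st v n)).
Proof.
  unfold active. split.
  - intros H; split; [intros m Hm|]; apply H; lia.
  - intros [H1 H2] m Hm. destruct (Nat.eq_dec m n) as [->|]; auto. apply H1; lia.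
Qed.

Lemma st_eq n v u : active n v -> piece (st v n) u -> st u n = st v n /\ active n u.
Proof.
  induction n as [|n IH]; intros Av Hu; [split; [auto|intros m Hm; lia]|].
  apply active_S in Av as [Av Nv]. destruct (st_sub v n Nv u Hu) as [Ku Nu].
  destruct (IH Av Ku) as [e Au].
  split; [|apply active_S; split; auto; now rewrite e].
  simpl. rewrite e. apply next_eq; auto.
Qed.

Lemma st_mono v m n : active n v -> m <= n -> forall x, piece (st v n) x -> piece (st v m) x.
Proof.
  intros Av Hm. induction Hm as [|n Hm IH]; auto. apply active_S in Av as [Av Nv].
  intros x Hx. apply IH; auto. now apply (st_sub v n).
Qed.

Context (ball : nat -> list V) (ball_rank : forall v n, rank v <= n -> In v (ball n)).

(* When a piece whose target has minimal rank is left for good, the target has been separated from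
   [v], so [v] sees one vertex fewer of its finite ball. *)
Lemma covered v : exists n, In v (core G (st v n)).
Proof.
  apply NNPP; intros N.
  assert (Nv : forall n, ~ In v (core G (st v n))) by eauto.
  assert (Av : forall n, active n v) by (intros n m _; auto). clear N.
  set (minimal := fun n => forall y, piece (st v n) y -> rank (target (st v n)) <= rank y).
  assert (Hrest : forall n, exists m, n <= m /\ block G (st v m) v).
  { apply (rest_often (st v) (fun _ => v)). intros i. destruct (st_inv v i); auto. }
  (* At the next step inside a block the new target is minimal. The old target cannot have survived,
     since by [succ_target] it survives chain steps only. *)
  assert (Hstep : forall n, exists m, n < m /\ minimal m /\ ~ piece (st v m) (target (st v n))).
  { intros n. destruct (Hrest n) as (m & Hm & Hb). exists (S m). split; [lia|].
    destruct (st_succ v m (Nv m)) as (HS & _). split.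
    - destruct HS; tauto.
    - intros Ht.
      assert (He : forall j, n <= j -> j <= S m -> target (st v j) = target (st v n)).
      { intros j Hj. induction Hj as [|j Hj IH]; auto. intros Hj'. rewrite <- IH by lia.
        apply (succ_target (st v j) v); [apply st_inv|apply st_succ; auto|].
        rewrite IH by lia. apply (st_mono v _ (S m)); auto. }
      assert (e : target (st v m) = target (st v n)) by (apply He; lia).
      rewrite <- e in Ht. apply succ_target in HS; [tauto|apply st_inv|auto]. }
  assert (Hfin : forall c n, minimal n -> count (piece (st v n)) (ball (rank v)) = c -> False).
  { induction c as [c IH] using lt_wf_ind. intros n Hn Hc.
    destruct (Hstep n) as (m & Hm & Hmin & Ht).
    apply (IH (count (piece (st v m)) (ball (rank v)))) with m; auto.
    rewrite <- Hc. apply count_lt with (target (st v n)); auto.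
    - intros x _. apply st_mono; auto. lia.
    - apply ball_rank, Hn. apply st_inv.
    - destruct (st_inv v n) as [I _]. apply I. }
  destruct (Hstep 0) as (m & _ & Hm & _). eapply Hfin; eauto.
Qed.

(** * The spanning cactus *)

Definition depth (v : V) : nat :=
  epsilon (inhabits 0) (fun n => In v (core G (st v n)) /\ active n v).
Definition owner (v : V) : state V := st v (depth v).

Lemma depth_spec v : In v (core G (owner v)) /\ active (depth v) v.
Proof.
  unfold owner, depth. apply (epsilon_spec (inhabits 0)
    (fun n => In v (core G (st v n)) /\ active n v)).
  destruct (covered v) as (n & Hn). revert Hn.
  induction n as [n IH] using lt_wf_ind. intros Hn.
  destruct (classic (active n v)) as [A|N]; [eauto|].
  apply not_all_ex_not in N as (m & N). apply imply_to_and in N as [Hm N].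
  apply NNPP in N. eauto.
Qed.

Lemma depth_unique v n : In v (core G (st v n)) -> active n v -> depth v = n.
Proof.
  intros Hn An. destruct (depth_spec v) as [Hd Ad].
  destruct (lt_eq_lt_dec (depth v) n) as [[H|H]|H]; auto; exfalso.
  - now apply (An _ H).
  - now apply (Ad _ H).
Qed.

Lemma core_owner n v u : active n v -> In u (core G (st v n)) ->
  depth u = n /\ owner u = st v n.
Proof.
  intros Av Hu. destruct (st_inv v n) as [I _].
  destruct (st_eq n v u Av) as [e Au].
  { apply core_spec in I; auto. destruct I as (_ & Cb & _). exact (ec_in _ _ _ _ (Cb u Hu)). }
  assert (Hd : depth u = n) by (apply depth_unique; auto; now rewrite e).
  split; auto. unfold owner. now rewrite Hd.
Qed.

Lemma active_le m n v : m <= n -> active n v -> active m v.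
Proof. intros H A k Hk. apply A. lia. Qed.

Lemma piece_depth n v u : active n v -> piece (st v n) u -> n <= depth u.
Proof.
  intros Av Hu. destruct (st_eq n v u Av Hu) as [_ Au].
  destruct (depth_spec u) as [Hd _]. apply Nat.nlt_ge. intros H. now apply (Au _ H).
Qed.

Lemma core_piece n v u : In u (core G (st v n)) -> piece (st v n) u.
Proof.
  intros Hu. destruct (st_inv v n) as [I _]. apply core_spec in I as (_ & Cb & _); auto.
  exact (ec_in _ _ _ _ (Cb u Hu)).
Qed.

Lemma start_core v n : In (start (st v n)) (core G (st v n)).
Proof. destruct (st_inv v n) as [I _]. now apply core_spec in I. Qed.

Lemma start_owner v : owner (start (owner v)) = owner v /\ depth (start (owner v)) = depth v.
Proof.
  destruct (core_owner (depth v) v (start (owner v))); auto.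
  - apply depth_spec.
  - apply start_core.
Qed.

Lemma owner_cases v : (core G (owner v) = [v] /\ start (owner v) = v) \/
  is_cycle G (core G (owner v)).
Proof.
  destruct (st_inv v (depth v)) as [I _]. fold (owner v) in I.
  apply core_spec in I as (_ & _ & _ & [[_ e]|[_ Hc]]); auto. left.
  destruct (depth_spec v) as [Hv _]. rewrite e in *. destruct Hv as [->|[]]. auto.
Qed.

(** The anchor changes only when the block has unspanned vertices; such a block is not trivial, so
    its core is a cycle. *)
Lemma anchor_core n v : active n v -> anchor (st v n) = [] \/
  exists m, m < n /\ anchor (st v n) = core G (st v m) /\ is_cycle G (core G (st v m)).
Proof.
  induction n as [|n IH]; intros Av; [auto|]. apply active_S in Av as [Av Nv].
  destruct (st_succ v n Nv) as (HS & _).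
  destruct HS as [Hb _ e _ _ _|_ _ e _ _ _|b _ _ e _ _ _ _ _]; rewrite e.
  - right. exists n. repeat split; auto. destruct (st_inv v n) as [I _].
    apply core_spec in I as (_ & _ & _ & [[T C]|[_ Hc]]); auto.
    exfalso. apply Nv. rewrite C. left. symmetry. now apply T.
  - destruct (IH Av) as [H|(m & Hm & H)]; auto. right; exists m; auto.
  - destruct (IH Av) as [H|(m & Hm & H)]; auto. right; exists m; auto.
Qed.

Lemma anchor_owner n v a : active n v -> In a (anchor (st v n)) ->
  depth a < n /\ is_cycle G (core G (owner a)).
Proof.
  intros Av Ha. destruct (anchor_core n v Av) as [e|(m & Hm & e & Hc)]; rewrite e in Ha.
  - contradiction.
  - destruct (core_owner m v a) as [<- ->]; auto. apply (active_le m n); auto. lia.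
Qed.

Lemma tip_cases n v : ~ In v (core G (st v n)) ->
  In (tip (st v (S n))) (anchor (st v (S n))) \/
  (In (tip (st v (S n))) (core G (st v n)) /\ ~ block G (st v n) v /\
   piece (st v (S n)) (target (st v n))).
Proof.
  intros Nv. destruct (st_succ v n Nv) as (HS & Hst & Gt).
  destruct HS as [Hb e _ Ht _ _|Hb e _ Bt et Pt|b _ _ _ Ht _ _ _ _]; auto.
  (* The gate towards the target is an exit, and the core was chosen to contain it. *)
  right. rewrite <- et. repeat split; auto.
  destruct (st_inv v n) as [I _]. apply core_spec in I as (_ & _ & Ce & _); auto.
  apply Ce. split; auto. right. exists (start (st v (S n))). split; auto.
  rewrite et, e in Pt. rewrite e in Hst.
  apply walk_trans with v; auto. now apply walk_sym.
Qed.

(* The entering edges, oriented away from the root. *)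
Definition up (x y : V) : Prop := 0 < depth y /\ y = start (owner y) /\ x = tip (owner y).

Lemma up_spec x y : up x y -> exists n, depth y = S n /\ ~ In y (core G (st y n)) /\
  active n y /\ owner y = st y (S n) /\ G x y /\ depth x < depth y.
Proof.
  intros (Hd & Hy & Hx). destruct (depth_spec y) as [Hc Ha]. unfold owner in *.
  destruct (depth y) as [|n]; [lia|]. exists n.
  pose proof Ha as Ha'. apply active_S in Ha as [Ha Nv].
  destruct (st_succ y n Nv) as (_ & _ & Gt). rewrite <- Hy, <- Hx in Gt.
  repeat split; auto.
  destruct (tip_cases n y Nv) as [H|(H & _)]; rewrite <- Hx in H.
  - now apply (anchor_owner _ _ _ Ha' H).
  - apply core_owner in H; auto. lia.
Qed.

Lemma up_not_core x y : up x y -> owner x <> owner y.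
Proof.
  intros H e. apply up_spec in H as (_ & _ & _ & _ & _ & _ & H).
  destruct (start_owner x) as [_ E1], (start_owner y) as [_ E2]. rewrite e in E1. lia.
Qed.

Lemma in_core_owner x y : In x (core G (owner y)) -> owner x = owner y.
Proof. intros H. apply core_owner in H; [tauto|apply depth_spec]. Qed.

(** Anchor vertices lie on cycles, so an edge entering a piece from a one-vertex core must continue
    the chain. *)
Lemma up_trivial x y : up x y -> core G (owner x) = [x] -> exists n,
  depth y = S n /\ ~ In y (core G (st y n)) /\ active n y /\ owner y = st y (S n) /\
  owner x = st y n /\ ~ block G (st y n) y /\ piece (st y (S n)) (target (st y n)).
Proof.
  intros H Hx. destruct (up_spec x y H) as (n & Hd & Ny & An & Hy & Gxy & _). exists n.
  destruct H as (_ & _ & e). rewrite Hy in e.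
  assert (An' : active (S n) y) by (apply active_S; auto).
  destruct (tip_cases n y Ny) as [Ht|(Ht & Hb & Hp)]; rewrite <- e in Ht.
  - apply anchor_owner in Ht as [_ Hc]; auto. rewrite Hx in Hc. destruct Hc as [Hc _].
    simpl in Hc. lia.
  - apply core_owner in Ht as [_ Ho]; auto. repeat split; auto.
Qed.

(** From a one-vertex core both edges enter the piece of the same target; on a cycle the degree
    bound leaves one edge. Hence the entering edges form disjoint paths. *)
Lemma up_inj x y y' : up x y -> up x y' -> y = y'.
Proof.
  intros H H'. destruct (owner_cases x) as [[Hx _]|Hc].
  - destruct (up_trivial x y H Hx) as (n & _ & Ny & An & Oy & Ox & By & Py).
    destruct (up_trivial x y' H' Hx) as (n' & _ & Ny' & An' & Oy' & Ox' & By' & Py').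
    assert (n = n').
    { transitivity (depth x); [symmetry|].
      - apply (core_owner n y); auto. rewrite <- Ox. apply depth_spec.
      - apply (core_owner n' y'); auto. rewrite <- Ox'. apply depth_spec. }
    subst n'. destruct H as (_ & -> & _), H' as (_ & -> & _). f_equal.
    assert (NT : ~ In (target (st y n)) (core G (st y n))).
    { intros HT. apply (st_sub y n Ny) in Py. tauto. }
    rewrite Oy, Oy'. simpl in *. rewrite <- Ox in Ny, Py, NT |- *. rewrite <- Ox' in Ny', Py' |- *.
    transitivity (next_state G rank (owner x) (target (owner x))); [symmetry|]; apply next_eq; auto.
  - apply (is_cycle_outer_nbr G (core G (owner x)) x); auto.
    + apply depth_spec.
    + intros N. apply (up_not_core x y H). symmetry. now apply in_core_owner.
    + intros N. apply (up_not_core x y' H'). symmetry. now apply in_core_owner.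
    + apply up_spec in H as (? & ?); tauto.
    + apply up_spec in H' as (? & ?); tauto.
Qed.

Definition span (u v : V) : Prop :=
  (exists w, is_cycle G (core G (owner w)) /\ cycle_edge (core G (owner w)) u v) \/
  up u v \/ up v u.

Lemma span_sym : symm span.
Proof.
  intros u v [(w & H1 & H2)|H]; [left|right; tauto].
  exists w. auto using cycle_edge_sym.
Qed.

Lemma span_sub u v : span u v -> G u v.
Proof.
  intros [(w & H1 & H2)|[H|H]].
  - eapply is_cycle_edge; eauto.
  - apply up_spec in H as (? & ?); tauto.
  - apply up_spec in H as (? & ?). apply G_sym; tauto.
Qed.

Definition span_cycles (c : list V) : Prop :=
  exists w, is_cycle G (core G (owner w)) /\ c = core G (owner w).

(** Maximal chains of entering edges; one-vertex chains are allowed, so these paths cover all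
    vertices. *)
Definition span_paths (p : list V) : Prop :=
  match p with
  | [] => False
  | x :: l => chain up x l /\ (forall y, ~ up y x) /\ (forall y, ~ up (last l x) y)
  end.

Lemma span_cycles_cycle c : span_cycles c -> is_cycle span c.
Proof.
  intros (w & Hc & e). subst c. destruct (core G (owner w)) as [|x l] eqn:e; [contradiction|].
  destruct Hc as (H1 & H2 & H3 & H4).
  assert (Hs : forall u v, cycle_edge (x :: l) u v -> span u v).
  { intros u v H. left. exists w. rewrite e. repeat split; auto. }
  repeat split; auto.
  - assert (H : forall q r, q ++ r = x :: l -> forall y r', r = y :: r' -> chain span y r').
    { clear - Hs. intros q r. revert q. induction r as [|a r IH]; intros q Hq y r' e; [discriminate|].
      injection e as <- <-. destruct r as [|b r]; [simpl; auto|]. split.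
      - apply Hs. left. exists q, r. auto.
      - apply (IH (q ++ [a])); auto. now rewrite <- app_assoc. }
    apply (H [] (x :: l)); auto.
  - apply Hs. right. exists x, l. auto.
Qed.

Lemma chain_up_depth x l : chain up x l -> forall y, In y l -> depth x < depth y.
Proof.
  revert x; induction l as [|z l IH]; intros x Hc y Hy; [contradiction|].
  destruct Hc as [H Hc]. apply up_spec in H as (n & _ & _ & _ & _ & _ & H).
  destruct Hy as [->|Hy]; auto. specialize (IH z Hc y Hy). lia.
Qed.

Lemma span_paths_path p : span_paths p -> is_path span p.
Proof.
  destruct p as [|x l]; [auto|]. intros (Hc & _ & _). split.
  - revert x Hc; induction l as [|y l IH]; intros x Hc.
    + constructor; auto; constructor.
    + constructor; [|apply IH; apply Hc].
      intros Hin. apply (chain_up_depth _ _ Hc) in Hin. lia.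
  - eapply chain_mono; [|exact Hc]. intros; right; auto.
Qed.

Lemma chain_up_unique x l l' : chain up x l -> chain up x l' ->
  (forall y, ~ up (last l x) y) -> (forall y, ~ up (last l' x) y) -> l = l'.
Proof.
  revert x l'; induction l as [|y l IH]; intros x [|y' l'] H H' N N'; auto.
  - destruct H' as [H' _]. now apply N in H'.
  - destruct H as [H _]. now apply N' in H.
  - destruct H as [H Hc], H' as [H' Hc']. rewrite last_cons in N, N'.
    rewrite <- (up_inj x y y') in * by auto. f_equal. eapply IH; eauto.
Qed.

Lemma chain_app_mid x l1 u l2 l : chain up x l -> x :: l = l1 ++ u :: l2 ->
  chain up u l2 /\ last l2 u = last l x /\
  ((l1 = [] /\ x = u) \/ exists l0 w, l1 = l0 ++ [w] /\ up w u).
Proof.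
  revert x l; induction l1 as [|a l1 IH]; intros x l Hc e; simpl in e.
  - injection e as -> ->. auto.
  - injection e as -> ->. destruct l1 as [|b l1].
    + simpl app in *. destruct Hc as [Hu Hc]. split; [auto|split]; [now rewrite last_cons|].
      right. exists [], a. auto.
    + destruct (IH b (l1 ++ u :: l2)) as (H1 & H2 & H3); [apply Hc|reflexivity|].
      split; [auto|split].
      * simpl app. now rewrite last_cons.
      * right. destruct H3 as [[? _]|(l0 & w & -> & Hw)]; [discriminate|].
        exists (a :: l0), w. auto.
Qed.

Lemma span_paths_next p x y : span_paths p -> In x p -> up x y ->
  exists l1 l2, p = l1 ++ x :: y :: l2.
Proof.
  destruct p as [|z l]; [contradiction|]. intros (Hc & _ & N) Hx Hxy.
  apply in_split in Hx as (l1 & l2 & e).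
  destruct (chain_app_mid z l1 x l2 l Hc e) as (H1 & H2 & _).
  destruct l2 as [|y' l2].
  - simpl in H2. rewrite <- H2 in N. now apply N in Hxy.
  - exists l1, l2. rewrite e. destruct H1 as [H1 _]. now rewrite (up_inj x y y').
Qed.

(** Both paths contain the unique predecessor of a common vertex, so they share their first vertex
    and then agree by [up_inj]. *)
Lemma span_paths_disjoint p p' x : span_paths p -> span_paths p' -> In x p -> In x p' -> p = p'.
Proof.
  intros Hp Hp'. remember (depth x) as n eqn:e. revert x e.
  induction n as [n IH] using lt_wf_ind. intros x -> Hx Hx'.
  destruct p as [|z l]; [contradiction|]. destruct p' as [|z' l']; [contradiction|].
  pose proof Hp as (Hc & N1 & N2). pose proof Hp' as (Hc' & N1' & N2').
  apply in_split in Hx as (l1 & l2 & e1). apply in_split in Hx' as (l1' & l2' & e1').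
  destruct (chain_app_mid z l1 x l2 l Hc e1) as (_ & _ & H).
  destruct (chain_app_mid z' l1' x l2' l' Hc' e1') as (_ & _ & H').
  destruct H as [[_ ->]|(l0 & w & -> & Hw)], H' as [[_ ->]|(l0' & w' & -> & Hw')].
  - f_equal. apply (chain_up_unique x); auto.
  - now apply N1 in Hw'.
  - now apply N1' in Hw.
  - assert (w = w') by (destruct Hw as (_ & _ & ->), Hw' as (_ & _ & ->); auto). subst w'.
    apply (IH (depth w)) with w; auto.
    + apply up_spec in Hw as (? & ?); tauto.
    + rewrite e1, !in_app_iff; simpl; auto.
    + rewrite e1', !in_app_iff; simpl; auto.
Qed.

(** Paths are finite lists, so every chain must stop. A chain that enters a cycle stops by the
    degree bound; through one-vertex cores, the path to the target shrinks at each step. *)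
Lemma chain_down v : exists l, chain up v l /\ forall y, ~ up (last l v) y.
Proof.
  assert (Hcyc : forall x y, up x y -> is_cycle G (core G (owner y)) -> forall z, ~ up y z).
  { intros x y H Hc z Hz.
    assert (x = z).
    { apply (is_cycle_outer_nbr G (core G (owner y)) y); auto.
      - apply depth_spec.
      - intros N. apply (up_not_core x y H). now apply in_core_owner.
      - intros N. apply (up_not_core y z Hz). symmetry. now apply in_core_owner.
      - apply G_sym. apply up_spec in H as (? & ?); tauto.
      - apply up_spec in Hz as (? & ?); tauto. }
    subst z. apply up_spec in H as (? & ?). apply up_spec in Hz as (? & ?). lia. }
  assert (Htriv : forall d y l, core G (owner y) = [y] -> target_path G (owner y) l -> length l = d ->
    exists l, chain up y l /\ forall z, ~ up (last l y) z).
  { induction d as [d IH] using lt_wf_ind. intros y l Hy Hl Hd.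
    destruct (classic (exists z, up y z)) as [(z & Hz)|N].
    2: { exists []. split; [simpl; auto|]. intros z Hz; apply N; eauto. }
    destruct (owner_cases z) as [[Ht _]|Hc].
    2: { exists [z]. split; [simpl; auto|]. intros u Hu. exact (Hcyc _ _ Hz Hc u Hu). }
    destruct (up_trivial y z Hz Hy) as (n & _ & Nz & An & Oz & Oy & Bz & Pz).
    destruct (st_succ z n Nz) as (HS & Hst & Gt). rewrite Oy in Hl.
    destruct (succ_chain_path (st z n) z (st z (S n)) l) as (l' & Hl' & Hlt); auto;
      [apply st_inv|].
    rewrite <- Oz in Hl'. rewrite Hd in Hlt.
    destruct (IH _ Hlt z l' Ht Hl' eq_refl) as (l2 & H1 & H2).
    exists (z :: l2). rewrite last_cons. simpl; auto. }
  destruct (classic (exists y, up v y)) as [(y & Hy)|N].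
  2: { exists []. split; [simpl; auto|]. intros y Hy; apply N; eauto. }
  destruct (owner_cases y) as [[Ht _]|Hc].
  - destruct (target_path_ex (owner y)) as (l & Hl); [apply st_inv|].
    destruct (Htriv _ y l Ht Hl eq_refl) as (l' & H1 & H2).
    exists (y :: l'). rewrite last_cons. simpl; auto.
  - exists [y]. split; [simpl; auto|]. exact (Hcyc v y Hy Hc).
Qed.

Lemma span_paths_cover v : exists p, span_paths p /\ In v p.
Proof.
  remember (depth v) as n eqn:e. revert v e.
  induction n as [n IH] using lt_wf_ind. intros v ->.
  destruct (classic (exists x, up x v)) as [(x & Hx)|N].
  - destruct (IH (depth x)) with x as (p & Hp & Hin); auto.
    { apply up_spec in Hx as (? & ?); tauto. }
    exists p. split; auto. destruct (span_paths_next p x v Hp Hin Hx) as (l1 & l2 & ->).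
    rewrite in_app_iff. simpl; auto.
  - destruct (chain_down v) as (l & H1 & H2). exists (v :: l). simpl. repeat split; eauto.
Qed.

Lemma same_bag_owner u v : same_bag span_cycles u v <-> owner u = owner v.
Proof.
  split.
  - intros [->|(c & (w & _ & ->) & Hu & Hv)]; auto.
    rewrite (in_core_owner u w), (in_core_owner v w); auto.
  - intros e. destruct (depth_spec u) as [Hu _], (depth_spec v) as [Hv _].
    destruct (owner_cases u) as [[H _]|Hc].
    + left. rewrite <- e, H in Hv. destruct Hv as [->|[]]. auto.
    + right. exists (core G (owner u)). repeat split; auto; [exists u; auto|now rewrite e].
Qed.

Lemma span_qedge u v : qedge span span_cycles u v <-> up u v \/ up v u.
Proof.
  assert (N : forall u v, up u v -> forall w, ~ cycle_edge (core G (owner w)) u v).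
  { clear u v. intros u v H w Hw. apply cycle_edge_in in Hw as [Hu Hv].
    apply (up_not_core u v H). rewrite (in_core_owner u w), (in_core_owner v w); auto. }
  split.
  - intros [[(w & H1 & H2)|H] Hn]; auto. exfalso. apply Hn. eexists; split; [exists w|]; eauto.
  - intros H. split; [right; auto|]. intros (c & (w & _ & ->) & Hw).
    destruct H as [H|H]; [|apply cycle_edge_sym in Hw]; eapply N; eauto.
Qed.

(* In a cycle of the contraction, the two edges at a bag of maximal depth would both be the unique
   edge entering that bag. *)
Lemma span_contraction : contraction_is_tree span span_cycles.
Proof.
  split.
  - set (E := fun a b => same_bag span_cycles a b \/ qedge span span_cycles a b).
    assert (HE : symm E).
    { intros a b. unfold E. rewrite !same_bag_owner, !span_qedge. intuition. }
    assert (Hroot : forall u, walk E (fun _ => True) u v0).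
    { intros u. remember (depth u) as n eqn:e. revert u e.
      induction n as [n IH] using lt_wf_ind. intros u ->.
      destruct (start_owner u) as [Ho Hd].
      destruct (Nat.eq_dec (depth u) 0) as [H0|H0].
      - apply walk_edge; auto. left. apply same_bag_owner. rewrite <- Ho. unfold owner.
        rewrite H0. reflexivity.
      - assert (Hup : up (tip (owner u)) (start (owner u))).
        { repeat split; [lia| |]; now rewrite Ho. }
        apply walk_step with (start (owner u)); auto.
        { left. now apply same_bag_owner. }
        apply walk_step with (tip (owner u)); auto.
        { right. apply span_qedge. auto. }
        apply up_spec in Hup as (? & ?). eapply IH; [|reflexivity]. lia. }
    intros u v. apply walk_conn_avoid with (fun _ => True); [auto|].
    apply walk_trans with v0; auto. apply walk_sym; auto.
  - intros (es & Hne & Hq & Hd & Hs & _).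
    assert (Hmax : forall l : list (V * V), l <> [] ->
      exists e, In e l /\ forall e', In e' l -> depth (fst e') <= depth (fst e)).
    { induction l as [|a l IH]; [congruence|]. intros _. destruct l as [|b l].
      - exists a. split; [simpl; auto|]. intros e [->|[]]. auto.
      - destruct IH as (e & He & Hm); [discriminate|].
        destruct (Nat.le_ge_cases (depth (fst e)) (depth (fst a))) as [H|H].
        + exists a. split; [simpl; auto|]. intros e' [->|H']; auto. specialize (Hm e' H'). lia.
        + exists e. split; [right; auto|]. intros e' [->|H']; auto. }
    destruct (Hmax es Hne) as ([a b] & He & Hm).
    apply In_nth_error in He as (i & Hi).
    assert (Hik : i < length es) by (apply nth_error_Some; congruence).
    assert (Hnext : forall j e, nth_error es j = Some e ->
      exists e', nth_error es (S j mod length es) = Some e' /\ depth (snd e) = depth (fst e')).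
    { intros j e Hj. destruct (nth_error es (S j mod length es)) as [e'|] eqn:Hj'.
      - exists e'. split; auto. specialize (Hs j e e' Hj Hj'). apply same_bag_owner in Hs.
        destruct (start_owner (snd e)) as [_ <-], (start_owner (fst e')) as [_ <-]. now rewrite Hs.
      - apply nth_error_None in Hj'.
        pose proof (Nat.mod_upper_bound (S j) (length es)). lia. }
    (* In the other orientation the next bag would be deeper. *)
    assert (Hab : up b a).
    { assert (Q : qedge span span_cycles a b) by (apply (Hq (a, b)); eapply nth_error_In; eauto).
      apply span_qedge in Q as [Q|Q]; auto.
      destruct (Hnext i _ Hi) as (e' & He' & Hde). apply nth_error_In, Hm in He'.
      simpl in *. apply up_spec in Q as (? & ?). lia. }
    (* The cyclic predecessor of [i]; it equals [i] when there is a single edge. *)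
    set (j := if Nat.eq_dec i 0 then length es - 1 else i - 1).
    assert (Hji : S j mod length es = i /\ j < length es).
    { unfold j. destruct (Nat.eq_dec i 0) as [->|Hi0]; split; try lia.
      - replace (S (length es - 1)) with (length es) by lia. apply Nat.Div0.mod_same.
      - replace (S (i - 1)) with i by lia. now apply Nat.mod_small. }
    destruct Hji as [Hji Hj].
    destruct (nth_error es j) as [[a' b']|] eqn:Hej.
    2: { apply nth_error_None in Hej. lia. }
    assert (Ho : owner b' = owner a).
    { apply same_bag_owner. apply (Hs j (a', b') (a, b)); auto. now rewrite Hji. }
    assert (Hab' : up a' b').
    { assert (Q : qedge span span_cycles a' b') by (apply (Hq (a', b')); eapply nth_error_In; eauto).
      apply span_qedge in Q as [Q|Q]; auto.
      pose proof (Hm (a', b') (nth_error_In _ _ Hej)) as Hm'. simpl in Hm'.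
      apply up_spec in Q as (? & ?).
      destruct (start_owner b') as [_ E1], (start_owner a) as [_ E2]. rewrite Ho in E1. lia. }
    pose proof Hab as (_ & Ea & Eb). pose proof Hab' as (_ & Eb' & Ea').
    rewrite Ho, <- Ea in Eb'. rewrite Ho, <- Eb in Ea'. subst a' b'.
    destruct (Nat.eq_dec i j) as [Hij|Hij].
    + rewrite <- Hij, Hi in Hej. injection Hej as -> _.
      apply up_spec in Hab as (? & ?). lia.
    + destruct (Hd i j _ _ Hij Hi Hej) as [_ N]. apply N. reflexivity.
Qed.

Lemma span_cactus : cactus span.
Proof.
  split.
  { intros v l Hl Hv. apply (G_sub v l Hl). intros u Hu. now apply span_sub, Hv. }
  exists span_cycles, span_paths. repeat split.
  - apply span_cycles_cycle.
  - apply span_paths_path.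
  - intros c1 c2 x (w1 & _ & ->) (w2 & _ & ->) H1 H2.
    apply in_core_owner in H1, H2. congruence.
  - apply span_paths_disjoint.
  - intros v. right. apply span_paths_cover.
  - intros u v [(w & H1 & H2)|H].
    + left. exists (core G (owner w)). split; auto. exists w; auto.
    + right. destruct H as [H|H].
      * destruct (span_paths_cover u) as (p & Hp & Hu). exists p. split; auto.
        destruct (span_paths_next p u v Hp Hu H) as (l1 & l2 & e). exists l1, l2. auto.
      * destruct (span_paths_cover v) as (p & Hp & Hv). exists p. split; auto.
        destruct (span_paths_next p v u Hp Hv H) as (l1 & l2 & e). exists l1, l2. auto.
  - apply span_contraction.
  - apply span_contraction.
Qed.

(** * Faithfulness *)

Definition settles (r : nat -> V) (n : nat) (s : state V) : Prop :=
  exists m, forall i, m <= i -> active n (r i) /\ st (r i) n = s.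

(** A tail of the ray avoids the core and the finite set of [succ_boundary], so its steps never
    change the next piece. *)
Lemma settles_ex r n : is_ray G r -> exists s, settles r n s.
Proof.
  intros Hr. induction n as [|n (s & m & Hm)].
  - exists root, 0. intros i _. split; [intros k Hk; lia|reflexivity].
  - destruct (Hm m (le_n m)) as [A0 e0].
    destruct (st_inv (r m) n) as [I _]. rewrite e0 in I.
    destruct (succ_boundary G G_simple G_sub rank s I) as (T & HT).
    destruct (ray_avoids r (core G s ++ T)) as (m1 & Hm1); [apply Hr|].
    set (M := Nat.max m m1).
    assert (HM : forall i, M <= i -> active n (r i) /\ st (r i) n = s /\ piece s (r i) /\
      ~ In (r i) (core G s) /\ ~ In (r i) T).
    { intros i Hi. destruct (Hm i) as [A e]; [lia|].
      specialize (Hm1 i ltac:(lia)). rewrite in_app_iff in Hm1.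
      destruct (st_inv (r i) n) as [_ Hp]. rewrite e in Hp. tauto. }
    exists (next_state G rank s (r M)), M. intros i Hi.
    induction Hi as [|i Hi [IHA IHe]].
    + destruct (HM M (le_n M)) as (A & e & _ & Nc & _). split.
      * apply active_S. now rewrite e.
      * simpl. now rewrite e.
    + destruct (HM i Hi) as (A & e & Hp & Nc & NT).
      destruct (HM (S i)) as (A' & e' & Hp' & Nc' & NT'); [lia|]. split.
      * apply active_S. now rewrite e'.
      * rewrite <- IHe. simpl. rewrite e, e'. apply next_eq; auto.
        apply NNPP; intros N. apply NT, (HT (r i) (r (S i))); auto. apply Hr.
Qed.

(** If the rays settled in different pieces, a connection avoiding the finite boundary of the first
    piece would have to leave that piece. *)
Lemma settles_equiv r1 r2 n s : is_ray G r1 -> is_ray G r2 -> ray_equiv G r1 r2 ->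
  settles r1 n s -> settles r2 n s.
Proof.
  intros H1 H2 Heq (m1 & Hm1). destruct (settles_ex r2 n H2) as (s2 & m2 & Hm2).
  enough (s2 = s) as <- by (exists m2; auto).
  destruct (Hm1 m1 (le_n m1)) as [A1 e1]. destruct (st_inv (r1 m1) n) as [I _]. rewrite e1 in I.
  destruct (inv_bd G s I) as (T & HT). destruct (Heq T) as (a & b & Ha & Hb & Hab).
  apply (conn_avoid_walk _ (fun x => ~ In x T)) in Hab; auto.
  assert (W : walk G (fun x => ~ In x T) (r1 (a + m1)) (r2 (b + m2))).
  { apply walk_trans with (r1 a); [apply walk_sym; auto|apply walk_trans with (r2 b); auto];
      apply ray_walk; auto. }
  destruct (Hm1 (a + m1)) as [A e]; [lia|]. destruct (Hm2 (b + m2)) as [A' e']; [lia|].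
  destruct (st_inv (r1 (a + m1)) n) as [_ Hp]. rewrite e in Hp.
  destruct (classic (piece s (r2 (b + m2)))) as [Hq|Hq].
  - rewrite <- e'. destruct (st_eq n (r1 (a + m1)) (r2 (b + m2)) A) as [E _]; congruence.
  - exfalso. destruct (walk_exit _ _ _ _ _ W Hp Hq) as (x & y & Px & Py & Tx & _ & Gxy).
    apply Tx, (HT x y); auto.
Qed.

(** The core is included because different parts of the piece may be entered from different vertices
    of it. *)
Definition region (v : V) (m : nat) (x : V) : Prop :=
  piece (st v (S m)) x \/ In x (core G (st v m)).

Lemma region_depth v m x : active (S m) v -> region v m x -> m <= depth x.
Proof.
  intros Av [H|H].
  - apply piece_depth in H; auto. lia.
  - apply active_S in Av as [Av _]. apply core_owner in H; auto. lia.
Qed.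

Lemma core_span_walk n v x y : active n v -> In x (core G (st v n)) -> In y (core G (st v n)) ->
  walk span (fun z => In z (core G (st v n))) x y.
Proof.
  intros Av Hx Hy. destruct (core_owner n v x Av Hx) as [_ E]. rewrite <- E in Hx, Hy |- *.
  destruct (owner_cases x) as [[e _]|Hc].
  - rewrite e in Hy |- *. destruct Hy as [<-|[]]. constructor. simpl; auto.
  - apply cycle_connected; auto using span_sym. intros u w H. left. exists x. auto.
Qed.

(** Inside the piece every later anchor is the core of stage [m] or a core within the piece, so
    nothing is entered from outside the region. *)
Lemma region_invariant v m u n : active (S m) v -> block G (st v m) v ->
  piece (st v (S m)) u -> S m <= n -> active n u ->
  (forall a, In a (anchor (st u n)) -> region v m a) /\ region v m (tip (st u n)).
Proof.
  intros Av Hb Hu Hn. apply active_S in Av as Av'. destruct Av' as [Av' Nv].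
  destruct (st_eq (S m) v u Av Hu) as [e _].
  induction Hn as [|n Hn IH]; intros Au.
  - rewrite e. destruct (st_succ v m Nv) as (HS & _).
    destruct HS as [_ _ eA Ht _ _|Nb _ _ _ _ _|b Nb _ _ _ _ _ _ _]; try contradiction.
    rewrite eA in *. split; [intros a Ha|]; right; auto.
  - apply active_S in Au as Au'. destruct Au' as [Au' Nu]. destruct (IH Au') as [IH1 _].
    assert (Hcore : forall a, In a (core G (st u n)) -> region v m a).
    { intros a Ha. left. rewrite <- e. apply (st_mono u (S m) n); auto. now apply core_piece. }
    assert (HA : forall a, In a (anchor (st u (S n))) -> region v m a).
    { destruct (st_succ u n Nu) as (HS & _).
      destruct HS as [_ _ eA _ _ _|_ _ eA _ _ _|b _ _ eA _ _ _ _ _]; rewrite eA; auto. }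
    split; auto. destruct (tip_cases n u Nu) as [H|(H & _)]; auto.
Qed.

(** From any vertex of the piece, its core leads to the start and the entering edge to a tip of
    smaller depth, still in the region; the descent ends on the core of stage [m], which is
    connected. *)
Lemma region_connected v m x y : active (S m) v -> block G (st v m) v ->
  region v m x -> region v m y -> walk span (region v m) x y.
Proof.
  intros Av Hb. apply active_S in Av as Av'. destruct Av' as [Av' _].
  assert (Hin : forall x, region v m x ->
    exists a, In a (core G (st v m)) /\ walk span (region v m) x a).
  { clear x y. intros x Hx. remember (depth x) as d eqn:ed. revert x ed Hx.
    induction d as [d IH] using lt_wf_ind. intros x -> Hx.
    destruct Hx as [Hx|Hx]; [|exists x; split; auto; constructor; right; auto].
    destruct (depth_spec x) as [Hc Ax].
    assert (Hd : S m <= depth x) by (eapply piece_depth; eauto).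
    destruct (region_invariant v m x (depth x) Av Hb Hx Hd Ax) as [_ Ht].
    destruct (start_owner x) as [Ho Hdo].
    assert (Hup : up (tip (owner x)) (start (owner x))).
    { repeat split; [lia| |]; now rewrite Ho. }
    assert (Hlt : depth (tip (owner x)) < depth x).
    { apply up_spec in Hup as (? & ?). lia. }
    destruct (IH _ Hlt (tip (owner x)) eq_refl Ht) as (a & Ha & W).
    exists a. split; auto.
    assert (Hsub : forall z, In z (core G (st x (depth x))) -> region v m z).
    { intros z Hz. left. destruct (st_eq (S m) v x Av Hx) as [<- _].
      apply (st_mono x (S m) (depth x)); auto. now apply core_piece. }
    apply walk_trans with (start (owner x)).
    - eapply walk_mono; [| |apply (core_span_walk (depth x) x); auto; apply start_core]; auto.
    - eapply walk_step; [apply Hsub, start_core| |exact W]. right; right; exact Hup. }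
  intros Hx Hy. destruct (Hin x Hx) as (a & Ha & Wa), (Hin y Hy) as (b & Hb' & Wb).
  apply walk_trans with a; auto. apply walk_trans with b; [|apply walk_sym; auto using span_sym].
  eapply walk_mono; [| |apply (core_span_walk m v a b); auto]; auto. intros z Hz; right; auto.
Qed.

Lemma settles_rest r n : is_ray G r -> exists v m, n <= m /\ active (S m) v /\
  block G (st v m) v /\ settles r m (st v m) /\ settles r (S m) (st v (S m)).
Proof.
  intros Hr.
  set (R := fun n => epsilon (inhabits root) (settles r n)).
  assert (HR : forall n, settles r n (R n)).
  { intros k. exact (epsilon_spec (inhabits root) _ (settles_ex r k Hr)). }
  clearbody R.
  assert (Hw : forall n, exists v, active (S n) v /\ st v n = R n /\ st v (S n) = R (S n)).
  { intros k. destruct (HR k) as (a & Ha), (HR (S k)) as (b & Hb).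
    exists (r (a + b)). destruct (Ha (a + b)); [lia|]. destruct (Hb (a + b)); [lia|]. auto. }
  set (w := fun n => epsilon (inhabits v0)
    (fun v => active (S n) v /\ st v n = R n /\ st v (S n) = R (S n))).
  assert (Hw' : forall n, active (S n) (w n) /\ st (w n) n = R n /\ st (w n) (S n) = R (S n)).
  { intros k. exact (epsilon_spec (inhabits v0) _ (Hw k)). }
  clearbody w.
  destruct (rest_often R w) with (n := n) as (m & Hm & Hb).
  - intros i. destruct (Hw' i) as (A & e & e'). apply active_S in A as [_ N].
    rewrite <- e, <- e'. destruct (st_inv (w i) i). auto.
  - exists (w m), m. destruct (Hw' m) as (A & e & e'). rewrite e, e'. auto.
Qed.

Lemma region_equiv (E : graph V) r1 r2 : (forall u v, span u v -> E u v) ->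
  (forall n, exists v m, n <= m /\ active (S m) v /\ block G (st v m) v /\
     (exists k, forall i, k <= i -> region v m (r1 i)) /\
     (exists k, forall i, k <= i -> region v m (r2 i))) ->
  ray_equiv E r1 r2.
Proof.
  intros HE H S.
  (* Region vertices have depth at least [m], and [m] exceeds every depth in [S]. *)
  destruct (H (Datatypes.S (list_max (map depth S)))) as (v & m & Hm & Av & Hb & (k1 & H1) & (k2 & H2)).
  assert (Hav : forall x, region v m x -> ~ In x S).
  { intros x Hx Hin. apply (region_depth v m x Av) in Hx.
    assert (Hle : Forall (fun d => d <= list_max (map depth S)) (map depth S)).
    { now apply list_max_le. }
    rewrite Forall_forall in Hle. specialize (Hle (depth x) (in_map depth S x Hin)). lia. }
  exists k1, k2. split; [|split].
  - intros i. apply Hav, H1. lia.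
  - intros j. apply Hav, H2. lia.
  - apply walk_conn_avoid with (region v m); auto.
    eapply walk_mono; [| |apply (region_connected v m)]; auto.
Qed.

Lemma settles_region r v m : settles r (S m) (st v (S m)) ->
  exists k, forall i, k <= i -> region v m (r i).
Proof.
  intros (k & Hk). exists k. intros i Hi. left. destruct (Hk i Hi) as [_ <-]. apply st_inv.
Qed.

(** The regions in which [r] settles at increasing stages are nested, connected in the cactus and
    without a common vertex; joining their starts gives the new ray. *)
Lemma end_has_span_ray r : is_ray G r -> exists r', is_ray span r' /\ ray_equiv G r r'.
Proof.
  intros Hr.
  set (good := fun n (p : V * nat) => n <= snd p /\ active (S (snd p)) (fst p) /\
    block G (st (fst p) (snd p)) (fst p) /\ settles r (snd p) (st (fst p) (snd p)) /\
    settles r (S (snd p)) (st (fst p) (S (snd p)))).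
  assert (Hex : forall n, exists p, good n p).
  { intros n. destruct (settles_rest r n Hr) as (v & m & H). exists (v, m). exact H. }
  set (pick := fun n => epsilon (inhabits (v0, 0)) (good n)).
  assert (Hpick : forall n, good n (pick n)).
  { intros n. exact (epsilon_spec (inhabits (v0, 0)) _ (Hex n)). }
  clearbody pick.
  set (q := fix q j := match j with 0 => pick 0 | S i => pick (S (snd (q i))) end).
  assert (Hq : forall j, exists n, good n (q j)) by (intros [|j]; eexists; apply Hpick).
  assert (Hinc : forall j, snd (q j) < snd (q (S j))).
  { intros j. destruct (Hpick (S (snd (q j)))) as [H _]. exact H. }
  assert (Hge : forall j, j <= snd (q j)).
  { induction j as [|j IH]; [lia|]. specialize (Hinc j). lia. }
  set (U := fun j => region (fst (q j)) (snd (q j))).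
  set (c := fun j => start (st (fst (q j)) (snd (q j)))).
  assert (HcU : forall j, In (c j) (core G (st (fst (q j)) (snd (q j))))).
  { intros j. apply start_core. }
  assert (Hdec1 : forall j x, U (S j) x -> U j x).
  { intros j x Hx. left.
    destruct (Hq j) as (n1 & _ & _ & _ & _ & m1 & S1).
    destruct (Hq (S j)) as (n2 & _ & A2 & _ & (m2 & S2) & (m3 & S3)).
    set (i := m1 + m2 + m3).
    destruct (S1 i) as [B1 e1]; [lia|]. destruct (S2 i) as [B2 e2]; [lia|].
    destruct (S3 i) as [B3 e3]; [lia|]. rewrite <- e1.
    specialize (Hinc j).
    apply (st_mono (r i) _ (snd (q (S j)))); auto.
    destruct Hx as [Hx|Hx].
    - rewrite <- e3 in Hx. apply st_sub in Hx; [tauto|]. now apply active_S in B3.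
    - rewrite e2. now apply core_piece. }
  assert (Hdec : forall i j x, i <= j -> U j x -> U i x).
  { intros i j x Hij. induction Hij as [|j Hij IH]; auto. }
  destruct (ray_from_walks span U c) as (r' & Hr' & HU).
  - intros j. destruct (Hq j) as (n & _ & A & B & _). apply region_connected; auto.
    + right. apply HcU.
    + apply Hdec1. right. apply HcU.
  - intros j e. specialize (Hinc j).
    destruct (Hq j) as (n & _ & A & _), (Hq (S j)) as (n' & _ & A' & _).
    apply active_S in A as [A _], A' as [A' _].
    destruct (core_owner _ _ _ A (HcU j)) as [d _], (core_owner _ _ _ A' (HcU (S j))) as [d' _].
    rewrite e in d. lia.
  - exact Hdec.
  - intros x. exists (S (depth x)). intros Hx.
    destruct (Hq (S (depth x))) as (n & _ & A & _).
    apply region_depth in Hx; auto. specialize (Hge (S (depth x))). lia.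
  - exists r'. split; auto. apply region_equiv; [apply span_sub|].
    intros n. destruct (Hq n) as (k & _ & A & B & _ & S1).
    exists (fst (q n)), (snd (q n)).
    refine (conj (Hge n) (conj A (conj B (conj _ (HU n))))). now apply settles_region.
Qed.

Lemma span_faithful : faithful span G.
Proof.
  split; [apply end_has_span_ray|]. intros r1 r2 H1 H2.
  assert (Hmono : forall r, is_ray span r -> is_ray G r).
  { intros r [Hi Hr]. split; auto. intros n. now apply span_sub. }
  split; intros H.
  - intros S. destruct (H S) as (m & n & Hm & Hn & Hc). exists m, n. repeat split; auto.
    apply walk_conn_avoid with (fun x => ~ In x S); auto.
    apply conn_avoid_walk with (K := fun x => ~ In x S) in Hc; auto.
    eapply walk_mono; [| |exact Hc]; auto using span_sub.
  - apply region_equiv; auto. intros n.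
    destruct (settles_rest r1 n) as (v & m & Hm & A & B & _ & HS); auto.
    exists v, m. refine (conj Hm (conj A (conj B (conj _ _)))); apply settles_region; auto.
    apply settles_equiv with r1; auto.
Qed.

End Progress.

(** * Bridgelessness, finite balls and the conclusion *)

(** The detour passes through a third vertex [w], reached from [u] avoiding [v] and left towards [v]
    avoiding [u]. *)
Lemma two_connected_bridgeless {V} (G : graph V) : simple G -> two_connected G ->
  forall u v, G u v -> walk (cut G u v) (fun _ => True) u v.
Proof.
  intros [Gs Gi] ((a & b & c & Hab & Hbc & Hac) & _ & H2) u v Guv.
  assert (Huv : u <> v) by (intros ->; now apply (Gi v)).
  assert (Hw : exists w, w <> u /\ w <> v).
  { destruct (classic (a = u \/ a = v)) as [Ha|Ha]; [|exists a; tauto].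
    destruct (classic (b = u \/ b = v)) as [Hb|Hb]; [|exists b; tauto].
    exists c. intuition congruence. }
  destruct Hw as (w & Hwu & Hwv).
  assert (Hcut : forall x y z, (x = u \/ x = v) -> y <> x -> z <> x ->
    walk (cut G u v) (fun _ => True) y z).
  { intros x y z Hx Hy Hz.
    eapply walk_mono; [| |apply (conn_avoid_walk G (fun t => t <> x) (fun t => t = x)); auto]; auto.
    intros s t Hs Ht Gst. repeat split; auto; intuition congruence. }
  apply walk_trans with w; [apply (Hcut v)|apply (Hcut u)]; auto.
Qed.

(** The rank is some radius whose ball contains the vertex, not necessarily the least one; what
    counts is that vertices of bounded rank lie in a finite list. *)
Lemma subcubic_balls {V} (G : graph V) (v0 : V) : subcubic G ->
  (forall v, walk G (fun _ => True) v0 v) ->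
  exists (rank : V -> nat) (ball : nat -> list V), forall v n, rank v <= n -> In v (ball n).
Proof.
  intros G3 Gc. destruct (subcubic_nbrs G G3) as (nbr & Hnbr).
  set (ball := fix ball n := match n with 0 => [v0] | S m => ball m ++ flat_map nbr (ball m) end).
  assert (Hball : forall v, exists n, In v (ball n)).
  { assert (H : forall u v, walk G (fun _ => True) u v -> (exists n, In u (ball n)) ->
      exists n, In v (ball n)).
    { induction 1 as [|u u' v _ Guu W IH]; auto. intros (n & Hn). apply IH.
      exists (S n). simpl. apply in_app_iff. right. apply in_flat_map. exists u.
      split; auto. now apply Hnbr. }
    intros v. apply (H v0); auto. exists 0. simpl; auto. }
  exists (fun v => epsilon (inhabits 0) (fun n => In v (ball n))), ball.
  intros v n Hn. induction Hn as [|n Hn IH].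
  - exact (epsilon_spec (inhabits 0) _ (Hball v)).
  - simpl. apply in_app_iff. auto.
Qed.

Theorem theorem7 (V : Type) (G : graph V) :
  simple G -> infinite_type V -> two_connected G -> subcubic G ->
  exists F : graph V, simple F /\ subgraph F G /\ cactus F /\ faithful F G.
Proof.
  intros GS _ G2 G3. pose proof (two_connected_bridgeless G GS G2) as Gb.
  destruct G2 as ((v0 & _) & Gc & _).
  assert (Gw : forall u v, walk G (fun _ => True) u v).
  { intros u v. apply (conn_avoid_walk _ _ (fun _ => False)); auto. }
  destruct (subcubic_balls G v0 G3 (Gw v0)) as (rank & ball & Hball).
  exists (span G rank v0). split; [split|split; [|split]].
  - apply span_sym.
  - intros v Hv. apply (proj2 GS v). eapply span_sub; eauto.
  - intros u v. eapply span_sub; eauto.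
  - eapply span_cactus; eauto.
  - eapply span_faithful; eauto.
Qed.
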